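(* Let $r\ge 1$ and $n\ge 1$ be integers, let $\zeta=\exp(2\pi i/r)$, and let the cyclic group $\mathbb{Z}/r\mathbb{Z}$ act freely on $\mathbb{C}^*$ by multiplication by $\zeta$. Let \[ F_{\mathbb{Z}/r\mathbb{Z}}(\mathbb{C}^*,n)=\{(x_1,\dots,x_n)\in(\mathbb{C}^* )^n \mid x_j\neq \zeta^k x_i \text{ for all } i\neq j,\ 1\le k\le r\} \] be the orbit configuration space. Then $\mathrm{TC}(F_{\mathbb{Z}/r\mathbb{Z}}(\mathbb{C}^*,n))=2n$.
   Context: For a path-connected space $Y$, $\mathrm{TC}(Y)$ denotes Farber's (unreduced) topological complexity: the smallest integer $m$ such that $Y\times Y$ admits a cover by $m$ open sets on each of which the path fibration $Y^{I}\to Y\times Y$, $\gamma\mapsto(\gamma(0),\gamma(1))$, admits a continuous section (so contractible spaces have $\mathrm{TC}=1$). *)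

(* Defs.v *)
From HB Require Import structures.
From mathcomp Require Import all_boot all_order all_algebra.
From mathcomp Require Import all_classical all_reals all_analysis.
Set Implicit Arguments. Unset Strict Implicit. Unset Printing Implicit Defensive.
Import Order.TTheory GRing.Theory Num.Theory.
Import numFieldNormedType.Exports.
Local Open Scope classical_set_scope.
Local Open Scope ring_scope.

(* The unit interval I = [0,1] with the subspace (initial) topology. *)
Notation unit_interval R := (set_type (`[0, 1]%classic : set R)).

(* A local motion planner on U ⊆ Y × Y: a continuous section over U of the
   path fibration Y^I -> Y × Y, γ ↦ (γ 0, γ 1), where Y^I is the space of
   continuous paths with the compact-open topology (the subspace of
   {compact-open, I -> Y} consisting of continuous maps). *)
Definition motion_planner (R : realType) (Y : topologicalType)
    (U : set (Y * Y)) : Prop :=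
  exists s : Y * Y -> {compact-open, unit_interval R -> Y},
    {within U, continuous s} /\
    forall z : Y * Y, U z ->
      [/\ continuous (s z : unit_interval R -> Y),
          (forall t : unit_interval R, set_val t = 0 -> s z t = z.1) &
          (forall t : unit_interval R, set_val t = 1 -> s z t = z.2)].

Definition TC_le (R : realType) (Y : topologicalType) (m : nat) : Prop :=
  exists U : 'I_m -> set (Y * Y),
    (forall i, open (U i) /\ motion_planner R (U i)) /\
    (forall z : Y * Y, exists i, U i z).

(* TC(Y) = m (Farber's unreduced topological complexity). *)
Definition is_TC (R : realType) (Y : topologicalType) (m : nat) : Prop :=
  TC_le R Y m /\ forall k, TC_le R Y k -> (m <= k)%N.

(* Complex numbers modelled as R × R (with the product topology). *)
Definition cmul (R : realType) (z w : R * R) : R * R :=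
  (z.1 * w.1 - z.2 * w.2, z.1 * w.2 + z.2 * w.1).

Definition zeta_pow (R : realType) (r k : nat) : R * R :=
  (cos (2 * pi * k%:R / r%:R), sin (2 * pi * k%:R / r%:R)).

Definition orbit_conf (R : realType) (r n : nat) : set {ptws 'I_n -> (R * R)%type} :=
  [set x | (forall i, x i <> (0, 0)) /\
           forall i j : 'I_n, i <> j -> forall k : nat, (1 <= k <= r)%N ->
             x j <> cmul (zeta_pow R r k) (x i)].

Notation orbit_conf_space R r n := (set_type (@orbit_conf R r n)).

(* Main.v *)
Require Import Defs.
From HB Require Import structures.
From mathcomp Require Import all_boot all_order all_algebra.
From mathcomp Require Import ring lra zify.
Set Implicit Arguments. Unset Strict Implicit. Unset Printing Implicit Defensive.
Import Order.TTheory GRing.Theory Num.Theory.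
Local Open Scope ring_scope.

(** Let X be the orbit configuration space and m = 2n - 1.

Lower bound. Let A be the n-torus in X whose points turn on concentric circles
around 0, and B the (n-1)-torus whose first point is fixed at 1 while the others
turn on small circles around it. On A x B the functions x_i and (x_l - x_0) / x_l
have, as differences between the two factors, the m angular coordinates of the
torus as their winding classes. A motion planner on U makes the pull-back of each
such difference to U null-homotopic. If m open sets sufficed, choose a grid on the
m-torus fine enough for each cell to lie in one of them: the i-th coordinate class
is a coboundary on the cells in the i-th set, hence is cohomologous to a cocycle
vanishing there. The cup product of the m modified cocycles is zero cell by cell,
although its integral over the torus is 1.

Upper bound. Call x_i and x_j aligned if they lie on the same ray up to a power of
zeta. The cells of X record the alignments, the order of the moduli within each
class and the power of zeta; the codimension n - #classes is at most n - 1. On the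
cell of x the moduli can be changed to a fixed set of distinct values, then each
x_j can be turned to plus or minus x_0, then to x_0 times a fixed configuration,
and finally the latter is moved by rescaling x_0 to y_0 along a segment, or along
two segments if y_0 / x_0 < 0. The sum of the two codimensions and of the last bit
takes 2n values, and cells with equal sums are separated from each other. *)

(** * Cochains on a discrete torus *)

Section DiscreteTorus.
Variables (R : numFieldType) (m K : nat).
Local Notation G := {ffun 'I_m -> 'I_K.+1}.
Implicit Types (d : 'I_m) (S : {set 'I_m}) (v : G) (b : G -> 'I_m -> R).
Implicit Types f : G -> {set 'I_m} -> R.

Definition step d : G := [ffun j => if j == d then inZp 1 else 0].

Definition insg d S : R := (-1) ^+ #|[set j in S | (j < d)%N]|.

(** Removing the smaller of two directions first takes away one predecessor of the larger one; the
    other sign is unaffected. *)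
Lemma insg_swap d d' S : d \in S -> d' \in S -> d != d' ->
  insg d S * insg d' (S :\ d) = - (insg d' S * insg d (S :\ d')).
Proof.
wlog lt_dd' : d d' / (d < d')%N.
  move=> H dS d'S dd'; have [lt|lt|eq] := ltngtP d d'.
  - exact: H.
  - by rewrite [in RHS]H ?opprK // eq_sym.
  - by rewrite (val_inj eq) eqxx in dd'.
move=> dS d'S _; rewrite /insg.
have -> : [set j in S :\ d' | (j < d)%N] = [set j in S | (j < d)%N].
  apply/setP=> j; rewrite !inE; case: (eqVneq j d') => //= ->.
  by rewrite ltnNge (ltnW lt_dd') andbF.
have -> : [set j in S | (j < d')%N] = d |: [set j in S :\ d | (j < d')%N].
  by apply/setP=> j; rewrite !inE; case: (eqVneq j d) => //= ->; rewrite dS lt_dd'.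
by rewrite cardsU1 !inE eqxx /= exprS mulN1r mulNr opprK mulrC.
Qed.

Lemma insg_dsum (F : 'I_m -> 'I_m -> R) S :
  (forall d d', d != d' -> F d d' = F d' d) ->
  \sum_(d in S) \sum_(d' in S :\ d) insg d S * insg d' (S :\ d) * F d d' = 0.
Proof.
move=> Fsym; set T := LHS; suff: - T = T.
  by move/eqP; rewrite eqr_oppLR -addr_eq0 -mulr2n mulrn_eq0 => /eqP.
rewrite /T -sumrN.
rewrite [RHS](exchange_big_dep (mem S)) /=; last by move=> d d' _; rewrite inE => /andP[].
apply: eq_bigr => d dS; rewrite -sumrN.
apply: eq_big => [d'|d']; first by rewrite !inE eq_sym dS andbT andbC.
rewrite !inE => /andP[dd' d'S].
by rewrite insg_swap ?inE // 1?eq_sym // mulNr opprK (Fsym d) // eq_sym.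
Qed.

(* [f v S] is the value of a cochain on the cubes based at [v] with edge
   directions [S]. [wedge b] is the left product with the 1-cochain [b]; [lead] is
   the same operator for the constant cochain 1, but without moving the base point. *)
Definition wedge b f v S :=
  \sum_(d in S) insg d S * b v d * f (v + step d) (S :\ d).

Definition lead f v S := \sum_(d in S) insg d S * f v (S :\ d).

Definition scal (g : G -> R) f v S := g v * f v S.

Definition unitc (v : G) S : R := (S == set0)%:R.

Definition cocycle b := forall v d d',
  b v d + b (v + step d) d' = b v d' + b (v + step d') d.

Definition dc (g : G -> R) v d := g (v + step d) - g v.

Notation one := (fun _ _ => 1).

Definition feq f f' := forall v S, f v S = f' v S.

Lemma wedge_ext b f f' : feq f f' -> feq (wedge b f) (wedge b f').
Proof. by move=> H v S; apply: eq_bigr => d _; rewrite H. Qed.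

Lemma wedgeZ b c f :
  feq (wedge b (fun v S => c * f v S)) (fun v S => c * wedge b f v S).
Proof. by move=> v S; rewrite mulr_sumr; apply: eq_bigr => d _; rewrite mulrCA. Qed.

Lemma wedgeB b f f' : feq (wedge b (fun v S => f v S - f' v S))
  (fun v S => wedge b f v S - wedge b f' v S).
Proof. by move=> v S; rewrite -sumrB; apply: eq_bigr => d _; rewrite mulrBr. Qed.

(** The sum of the two sides is a signed double sum with symmetric coefficients, since [lead] leaves
    the base point of [b] in place. *)
Lemma lead_wedge b f : feq (lead (wedge b f)) (fun v S => - wedge b (lead f) v S).
Proof.
move=> v S; apply/eqP; rewrite -addr_eq0; apply/eqP.
rewrite -[RHS](@insg_dsum (fun d d' => b v d * f (v + step d) (S :\ d :\ d')
                   + b v d' * f (v + step d') (S :\ d :\ d')) S); last first.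
  by move=> d d' dd'; rewrite addrC !setDDl [_ :|: _]setUC.
rewrite -big_split; apply: eq_bigr => d dS /=.
rewrite !mulr_sumr -big_split; apply: eq_bigr => d' dS' /=; ring.
Qed.

(** As in [lead_wedge], but both base points move: the symmetry of [b v d + b (v + step d) d'] is
    the cocycle condition. *)
Lemma one_wedge b f : cocycle b ->
  feq (wedge one (wedge b f)) (fun v S => - wedge b (wedge one f) v S).
Proof.
move=> cb v S; apply/eqP; rewrite -addr_eq0; apply/eqP.
rewrite -[RHS](@insg_dsum (fun d d' => (b v d + b (v + step d) d')
                    * f (v + step d + step d') (S :\ d :\ d')) S); last first.
  by move=> d d' dd'; rewrite cb addrAC !setDDl [_ :|: _]setUC.
rewrite -big_split; apply: eq_bigr => d dS /=.
rewrite !mulr_sumr -big_split; apply: eq_bigr => d' dS' /=; ring.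
Qed.

(** The Leibniz rule: the product with the coboundary of [g] is the commutator of [wedge one] with
    multiplication by [g]. *)
Lemma wedge_dc g f :
  feq (wedge (dc g) f) (fun v S => wedge one (scal g f) v S - scal g (wedge one f) v S).
Proof.
move=> v S; rewrite /scal mulr_sumr -sumrB; apply: eq_bigr => d _.
rewrite /dc; ring.
Qed.

Definition wedges (bs : seq (G -> 'I_m -> R)) f := foldr wedge f bs.

Lemma wedges_ext bs f f' : feq f f' -> feq (wedges bs f) (wedges bs f').
Proof. by elim: bs => //= b bs IH H; apply/wedge_ext/IH. Qed.

Lemma wedges_sub bs f f' : feq (wedges bs (fun v S => f v S - f' v S))
  (fun v S => wedges bs f v S - wedges bs f' v S).
Proof.
elim: bs => //= b bs IH v S; rewrite -wedgeB; exact: wedge_ext.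
Qed.

Lemma wedges_scale bs c f :
  feq (wedges bs (fun v S => c * f v S)) (fun v S => c * wedges bs f v S).
Proof.
by elim: bs => //= b bs IH v S; rewrite (wedge_ext _ IH) wedgeZ.
Qed.

Lemma lead_wedges bs f :
  feq (lead (wedges bs f)) (fun v S => (-1) ^+ size bs * wedges bs (lead f) v S).
Proof.
elim: bs => [|b bs IH] v S /=; first by rewrite mul1r.
rewrite lead_wedge (wedge_ext _ IH) wedgeZ.
by rewrite exprS mulN1r mulNr.
Qed.

Lemma one_wedges bs f : (forall b, List.In b bs -> cocycle b) ->
  feq (wedge one (wedges bs f))
      (fun v S => (-1) ^+ size bs * wedges bs (wedge one f) v S).
Proof.
elim: bs => [|b bs IH] cb v S /=; first by rewrite mul1r.
rewrite one_wedge; last by apply: cb; left.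
rewrite (wedge_ext _ (IH _)) ?wedgeZ; last by move=> b' ?; apply: cb; right.
by rewrite exprS mulN1r mulNr.
Qed.

Lemma lead_scal g f : feq (lead (scal g f)) (scal g (lead f)).
Proof.
by move=> v S; rewrite /scal mulr_sumr; apply: eq_bigr => d _; rewrite mulrCA.
Qed.

Lemma lead_unitc : feq (lead unitc) (wedge one unitc).
Proof. by move=> v S; apply: eq_bigr => d _; rewrite mulr1. Qed.

Definition torus_sum f := \sum_v f v setT.

(** The two operators differ by a translation of the base point, and the sum over the torus is
    translation invariant. *)
Lemma torus_sum_one f : torus_sum (wedge one f) = torus_sum (lead f).
Proof.
rewrite /torus_sum /wedge /lead exchange_big [RHS]exchange_big /=.
apply: eq_bigr => d _; rewrite (reindex_inj (addIr (- step d))) /=.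
by apply: eq_bigr => v _; rewrite subrK mulr1.
Qed.

(* Both halves of the commutator [wedge one, g] = wedge (dc g) are moved to
   the two ends of the word, where they differ by a translation. *)
Lemma torus_sum_exact bs1 bs2 g :
  (forall b, List.In b bs1 -> cocycle b) -> (forall b, List.In b bs2 -> cocycle b) ->
  torus_sum (wedges bs1 (wedge (dc g) (wedges bs2 unitc))) = 0.
Proof.
move=> c1 c2.
rewrite /torus_sum (eq_bigr (fun v => (-1) ^+ size bs1
    * wedge one (wedges bs1 (scal g (wedges bs2 unitc))) v setT
  - (-1) ^+ size bs2 * wedges bs1 (scal g (wedges bs2 (wedge one unitc))) v setT)).
  rewrite sumrB -!mulr_sumr -!/(torus_sum _) torus_sum_one.
  have -> : torus_sum (lead (wedges bs1 (scal g (wedges bs2 unitc)))) =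
    (-1) ^+ (size bs1 + size bs2) *
    torus_sum (wedges bs1 (scal g (wedges bs2 (wedge one unitc)))).
    rewrite /torus_sum mulr_sumr; apply: eq_bigr => v _.
    rewrite lead_wedges exprD -mulrA; congr (_ * _).
    rewrite -wedges_scale; apply: wedges_ext => {}v S.
    rewrite lead_scal /scal lead_wedges mulrCA; congr (_ * (_ * _)).
    by apply: wedges_ext; exact: lead_unitc.
  by rewrite mulrA exprD mulrA -expr2 sqrr_sign mul1r subrr.
move=> v _; rewrite (wedges_ext _ (wedge_dc _ _)) wedges_sub one_wedges //.
rewrite mulrA -expr2 sqrr_sign mul1r; congr (_ - _).
rewrite -wedges_scale; apply: wedges_ext => {}v S.
by rewrite /scal one_wedges // mulrCA.
Qed.

(** The closed form [dx_i], each circle being cut into [K.+1] edges of total length 1. *)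
Definition coord_form (i : 'I_m) (v : G) d : R := (d == i)%:R / K.+1%:R.

Lemma cocycle_coord_form i : cocycle (coord_form i).
Proof. by move=> v d d'; rewrite /coord_form addrC. Qed.

Lemma cocycleB_dc b g : cocycle b -> cocycle (fun v d => b v d - dc g v d).
Proof.
move=> cb v d d'; rewrite /dc addrACA cb [in RHS]addrACA; congr (_ + _).
rewrite [v + step d + _]addrAC; ring.
Qed.

(** Each factor leaves a single summand, whose sign is +1 because the list is increasing: its head
    is the least element of the set. *)
Lemma wedges_coord_form (s : seq 'I_m) v :
  sorted (relpre val ltn) s ->
  wedges [seq coord_form i | i <- s] (@unitc) v [set j in s] = (K.+1%:R^-1) ^+ size s.
Proof.
elim: s v => [|i s IH] v /=; first by rewrite /unitc (_ : [set _ in _] = set0) ?eqxx //; apply/setP=> j; rewrite !inE.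
rewrite path_sortedE; last by move=> y x z; exact: ltn_trans.
case/andP=> /allP lt_is srt.
have i_s : i \notin s by apply/negP => /lt_is /=; rewrite ltnn.
rewrite /wedge (bigD1 i) ?inE ?eqxx //= big1 ?addr0; last first.
  by move=> d /andP[_ /negPf d_i]; rewrite /coord_form d_i mul0r mulr0 mul0r.
have -> : [set j in i :: s] :\ i = [set j in s].
  by apply/setP => j; rewrite !inE; case: eqVneq => // ->; rewrite (negPf i_s).
rewrite IH // /coord_form eqxx mul1r exprS; congr (_ * _).
rewrite /insg (_ : [set _ in _ | _] = set0) ?cards0 ?mul1r //.
apply/setP => j; rewrite !inE; case: eqVneq => [->|_] /=; first by rewrite ltnn.
by apply/negP => /andP[/lt_is /= /ltnW]; rewrite leqNgt => /negP.
Qed.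

(** The factors in front of [b] move the base point along the directions [T] that they use up, so
    [b] is only evaluated on edges of the cube at [v]. *)
Lemma wedges_vanish bs b f v S : List.In b bs ->
  (forall (T : {set 'I_m}) d, T \subset S -> d \in S :\: T ->
     b (v + \sum_(j in T) step j) d = 0) ->
  wedges bs f v S = 0.
Proof.
elim: bs v S => //= b' bs IH v S [<-|bbs] H; apply: big1 => d dS.
  have := H set0 d; rewrite sub0set big_set0 addr0 => -> //.
    by rewrite mulr0 mul0r.
  by rewrite setD0.
rewrite IH ?mulr0 // => T d' sTS; rewrite !inE => /and3P[d'T d'd d'S].
have dT : d \notin T by apply/negP => /(subsetP sTS); rewrite !inE eqxx.
have := H (d |: T) d'; rewrite big_setU1 // addrA; apply.
  by rewrite subUset sub1set dS (subset_trans sTS) // subsetDl.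
by rewrite !inE negb_or d'd d'T.
Qed.

(* The top product of the coordinate classes is nonzero on the torus, although
   in the situation excluded here each cell kills one of its factors. *)
Theorem torus_no_primitives (h : 'I_m -> G -> R) :
  ~ (forall v, exists i, forall (T : {set 'I_m}) d, d \notin T ->
      dc (h i) (v + \sum_(j in T) step j) d = (d == i)%:R / K.+1%:R).
Proof.
move=> H; pose b' i v d := coord_form i v d - dc (h i) v d.
(* The forms are replaced by [b'] one at a time; each replacement changes the sum by an exact term,
   which integrates to 0. *)
have replace s1 s2 : torus_sum (wedges (map b' s1 ++ map coord_form s2) (@unitc))
    = torus_sum (wedges (map coord_form (s1 ++ s2)) (@unitc)).
  elim/last_ind: s1 s2 => [|s1 i IH] s2 //; rewrite cat_rcons -IH map_rcons cat_rcons.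
  apply/eqP; rewrite -subr_eq0 -oppr_eq0 opprB; apply/eqP.
  rewrite -[RHS](@torus_sum_exact (map b' s1) (map coord_form s2) (h i)).
  - rewrite /torus_sum -sumrB; apply: eq_bigr => v _.
    rewrite /wedges !foldr_cat /= -/(wedges _ _) -/(wedges _ _) -/(wedges _ _).
    rewrite -wedges_sub; apply: wedges_ext => {}v S.
    rewrite /wedge -sumrB; apply: eq_bigr => d _.
    rewrite /b'; ring.
  - by move=> b /List.in_map_iff[j [<- _]]; exact/cocycleB_dc/cocycle_coord_form.
  - by move=> b /List.in_map_iff[j [<- _]]; exact/cocycle_coord_form.
have := replace (enum 'I_m) [::]; rewrite !cats0 /torus_sum.
rewrite big1 => [|v _]; last first.
  have [i Hi] := H v; apply: (@wedges_vanish _ (b' i)).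
    by apply: List.in_map; elim: (enum _) (mem_enum 'I_m i) => //= j s IH;
      rewrite !inE => /orP[/eqP->|/IH]; [left|right].
  by move=> T d _; rewrite inE => /andP[dT _]; rewrite /b' Hi // /coord_form subrr.
rewrite (eq_bigr (fun=> K.+1%:R^-1 ^+ m)) => [|v _]; last first.
  have := @wedges_coord_form (enum 'I_m) v; rewrite size_enum_ord => <-.
    by congr (wedges _ _ _ _); apply/setP => j; rewrite !inE mem_enum.
  by rewrite -sorted_map val_enum_ord iota_ltn_sorted.
move/eqP; rewrite sumr_const card_ffun !card_ord -[_ *+ (_ ^ _)]mulr_natr natrX -exprMn.
by rewrite mulVf ?expr1n ?pnatr_eq0 // eq_sym oner_eq0.
Qed.

End DiscreteTorus.

From mathcomp Require Import all_classical all_reals all_analysis.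
Import numFieldNormedType.Exports.
Local Open Scope classical_set_scope.
Local Open Scope ring_scope.

(** * Continuity at a point *)

Section PointContinuity.
Variable R : realType.

Lemma cont_cst (T U : topologicalType) (u : U) (x : T) : {for x, continuous (fun _ : T => u)}.
Proof. exact: cvg_cst. Qed.

Lemma cont_id (T : topologicalType) (x : T) : {for x, continuous (fun y : T => y)}.
Proof. exact: cvg_id. Qed.

Lemma cont_comp (T U V : topologicalType) (f : T -> U) (g : U -> V) x :
  {for x, continuous f} -> {for f x, continuous g} -> {for x, continuous (fun y => g (f y))}.
Proof. exact: continuous_comp. Qed.

Lemma cont_pair (T U V : topologicalType) (f : T -> U) (g : T -> V) x :
  {for x, continuous f} -> {for x, continuous g} ->
  {for x, continuous (fun y => (f y, g y))}.
Proof. exact: cvg_pair. Qed.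

Lemma cont_fst (T U V : topologicalType) (f : T -> U * V) x :
  {for x, continuous f} -> {for x, continuous (fun y => (f y).1)}.
Proof. by move=> cf; apply: (@continuous_comp _ _ _ f fst) => //; exact: cvg_fst. Qed.

Lemma cont_snd (T U V : topologicalType) (f : T -> U * V) x :
  {for x, continuous f} -> {for x, continuous (fun y => (f y).2)}.
Proof. by move=> cf; apply: (@continuous_comp _ _ _ f snd) => //; exact: cvg_snd. Qed.

Variable T : topologicalType.
Implicit Types (f g : T -> R) (x : T).

Lemma contD f g x : {for x, continuous f} -> {for x, continuous g} ->
  {for x, continuous (fun y => f y + g y)}.
Proof. exact: cvgD. Qed.

Lemma contN f x : {for x, continuous f} -> {for x, continuous (fun y => - f y)}.
Proof. exact: cvgN. Qed.

Lemma contB f g x : {for x, continuous f} -> {for x, continuous g} ->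
  {for x, continuous (fun y => f y - g y)}.
Proof. exact: cvgB. Qed.

Lemma contM f g x : {for x, continuous f} -> {for x, continuous g} ->
  {for x, continuous (fun y => f y * g y)}.
Proof. exact: cvgM. Qed.

Lemma contV f x : f x != 0 -> {for x, continuous f} ->
  {for x, continuous (fun y => (f y)^-1)}.
Proof. by move=> fx0; exact: cvgV. Qed.

Lemma cont_sqrt f x : {for x, continuous f} ->
  {for x, continuous (fun y => Num.sqrt (f y))}.
Proof. by move=> cf; apply: cont_comp => //; exact: sqrt_continuous. Qed.

Lemma cont_cos f x : {for x, continuous f} -> {for x, continuous (fun y => cos (f y))}.
Proof. by move=> cf; apply: cont_comp => //; exact: continuous_cos. Qed.

Lemma cont_sin f x : {for x, continuous f} -> {for x, continuous (fun y => sin (f y))}.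
Proof. by move=> cf; apply: cont_comp => //; exact: continuous_sin. Qed.

Lemma cont_min f g x : {for x, continuous f} -> {for x, continuous g} ->
  {for x, continuous (fun y => Num.min (f y) (g y))}.
Proof. exact: continuous_min. Qed.

Lemma cont_max f g x : {for x, continuous f} -> {for x, continuous g} ->
  {for x, continuous (fun y => Num.max (f y) (g y))}.
Proof. exact: continuous_max. Qed.

Lemma cont_gt0 f x : {for x, continuous f} -> 0 < f x -> \forall y \near x, 0 < f y.
Proof. by move=> cf fx; exact: (cf _ (lt_nbhsr fx)). Qed.

Lemma cont_neq0 f x : {for x, continuous f} -> f x != 0 -> \forall y \near x, f y != 0.
Proof.
move=> cf fx; have : 0 < `|f x| by rewrite normr_gt0.
have cn : {for x, continuous (fun y => `|f y|)} by exact: cvg_norm.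
by move/(cont_gt0 cn); apply: filterS => y; rewrite normr_gt0.
Qed.

End PointContinuity.

(** * Oriented angles *)

Section Angles.
Variable R : realType.
Local Notation C := (R * R)%type.
Implicit Types a b c : C.

(** [dot a b] and [cross a b] are the real and imaginary parts of the conjugate of [a] times [b]. *)
Definition dot a b := a.1 * b.1 + a.2 * b.2.
Definition cross a b := a.1 * b.2 - a.2 * b.1.

(* Meaningful only when [0 < dot a b]. *)
Definition ang a b := atan (cross a b / dot a b).

Definition cis (x : R) : C := (cos x, sin x).

Lemma dot_self_gt0 a : a <> (0, 0) -> 0 < dot a a.
Proof.
move=> a0; rewrite /dot -!expr2 lt_neqAle addr_ge0 ?sqr_ge0 // andbT eq_sym.
apply: contra_notN a0; rewrite paddr_eq0 ?sqr_ge0 // !sqrf_eq0.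
by case: a => a1 a2 /= /andP[/eqP-> /eqP->].
Qed.

Lemma continuous_dot (T : topologicalType) (f g : T -> C) x :
  {for x, continuous f} -> {for x, continuous g} ->
  {for x, continuous (fun y => dot (f y) (g y))}.
Proof.
by move=> cf cg; apply: contD; apply: contM; first [exact: cont_fst | exact: cont_snd].
Qed.

Lemma cos_le0_pihalf (x : R) : pi / 2 <= x < pi -> cos x <= 0.
Proof.
move=> /andP[x1 x2]; have -> : x = x - pi + pi by ring.
rewrite cosDpi oppr_le0; apply: cos_ge0_pihalf; apply/andP; split; lra.
Qed.

Lemma cos_gt0_itv (x : R) : - pi < x < pi -> 0 < cos x -> - (pi / 2) < x < pi / 2.
Proof.
move=> /andP[x1 x2] cx; rewrite !ltNge -negb_or; apply/negP => /orP[H|H].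
  suff : cos x <= 0 by rewrite leNgt cx.
  by rewrite -cosN; apply: cos_le0_pihalf; apply/andP; split; lra.
suff : cos x <= 0 by rewrite leNgt cx.
by apply: cos_le0_pihalf; apply/andP.
Qed.

(** The tangent addition formula; positivity of the three dot products keeps the sum of the two
    angles within a quarter turn of 0, where the tangent is injective. *)
Lemma ang_add a b c : 0 < dot a b -> 0 < dot b c -> 0 < dot a c ->
  ang a b + ang b c = ang a c.
Proof.
move=> ab bc ac; rewrite /ang.
set t1 := cross a b / _; set t2 := cross b c / _.
have bb : 0 < dot b b.
  apply: dot_self_gt0 => b0; move: ab.
  by rewrite b0 /dot /= !mulr0 addr0 ltxx.
have E1 : 1 - t1 * t2 = dot b b * dot a c / (dot a b * dot b c).
  rewrite /t1 /t2 /dot /cross in ab bc *; field; apply/andP; split; exact: lt0r_neq0.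
have E2 : t1 + t2 = dot b b * cross a c / (dot a b * dot b c).
  rewrite /t1 /t2 /dot /cross in ab bc *; field; apply/andP; split; exact: lt0r_neq0.
have p1 : 0 < 1 - t1 * t2 by rewrite E1 divr_gt0 // mulr_gt0.
have ca t : 0 < cos (@atan R t) by apply: cos_gt0_pihalf; rewrite atan_gtNpi2 atan_ltpi2.
have sa t : sin (@atan R t) = t * cos (atan t).
  by rewrite -{2}(atanK t) /tan divfK // lt0r_neq0.
have cs : 0 < cos (atan t1 + atan t2).
  rewrite cosD !sa.
  have -> : cos (atan t1) * cos (atan t2) - t1 * cos (atan t1) * (t2 * cos (atan t2))
    = (1 - t1 * t2) * (cos (atan t1) * cos (atan t2)) by ring.
  by rewrite !mulr_gt0.
have itv : - (pi / 2) < atan t1 + atan t2 < pi / 2.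
  apply: cos_gt0_itv => //.
  have := atan_gtNpi2 t1; have := atan_gtNpi2 t2.
  have := atan_ltpi2 t1; have := atan_ltpi2 t2.
  move=> *; apply/andP; split; lra.
rewrite -[LHS]tanK ?in_itv //= tanD ?lt0r_neq0 // !atanK E1 E2; congr atan.
rewrite -[X in X / _]mulrA -[X in _ / X]mulrA.
have : dot a c != 0 by exact: lt0r_neq0.
have : dot a b != 0 by exact: lt0r_neq0.
have : dot b c != 0 by exact: lt0r_neq0.
have : dot b b != 0 by exact: lt0r_neq0.
move: (dot a c) (dot a b) (dot b c) (dot b b) => x1 x2 x3 x4 *; field.
by repeat (apply/andP; split).
Qed.

(** Discrete homotopy invariance: each square between the two polygons is cut by the diagonal from
    [s k] to [s' k.+1] into two triangles, to which [ang_add] applies. *)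
Lemma ang_sum (s s' : nat -> C) n :
  (forall k, (k < n)%N -> [/\ 0 < dot (s k) (s k.+1), 0 < dot (s k) (s' k.+1) &
                            0 < dot (s' k) (s' k.+1)]) ->
  (forall k, (k <= n)%N -> 0 < dot (s k) (s' k)) ->
  \sum_(k < n) ang (s k) (s k.+1) + ang (s n) (s' n) =
  ang (s 0%N) (s' 0%N) + \sum_(k < n) ang (s' k) (s' k.+1).
Proof.
elim: n => [|n IH] H1 H2; first by rewrite !big_ord0 addrC.
rewrite !big_ord_recr /= addrA -IH; first last.
- by move=> k kn; apply/H2/leqW.
- by move=> k kn; apply/H1/leqW.
have [a1 a2 a3] := H1 n (leqnn _).
by rewrite -!addrA; congr (_ + _); rewrite !ang_add ?H2.
Qed.

Lemma dot_cis x y : dot (cis x) (cis y) = cos (y - x).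
Proof. by rewrite cosB /dot /cis /=; ring. Qed.

Lemma ang_cis x y : - (pi / 2) < y - x < pi / 2 -> ang (cis x) (cis y) = y - x.
Proof.
move=> H; rewrite /ang dot_cis -[RHS]tanK ?in_itv //; congr (atan (_ / _)).
by rewrite sinB /cross /cis /=; ring.
Qed.

Lemma ang0 a : ang a a = 0.
Proof. by rewrite /ang /cross [X in X - _]mulrC subrr mul0r atan0. Qed.

Lemma cis_periodic (x : R) n : cis (x + n%:R * (pi *+ 2)) = cis x.
Proof.
by rewrite mulr_natl /cis (periodicn (@cosD2pi R)) (periodicn (@sinD2pi R)).
Qed.

End Angles.

(** * Winding numbers over a cover of the torus *)

Section WindingCover.
Variables (R : realType) (m : nat).
Local Notation C := (R * R)%type.

Definition torus_pt (p : 'rV[R]_m) (j : 'I_m) : C := cis (2 * pi * p ord0 j).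

Variable V : 'I_m -> set 'rV[R]_m.
(** Over [V i], [w i p] is a path in the punctured plane from the right half-plane to the half-plane
    around the [i]-th coordinate of [p] on the torus; its total angle will give a primitive of that
    coordinate class. *)
Variable w : 'I_m -> 'rV[R]_m -> R -> C.
Hypothesis Vcover : forall p, exists i, V i p.
Hypothesis w_cont : forall i p t, V i p ->
  {for (p, t), continuous (fun z : 'rV[R]_m * R => w i z.1 z.2)}.
Hypothesis w_neq0 : forall i p t, V i p -> w i p t <> (0, 0).
Hypothesis w_start : forall i p, V i p -> 0 < (w i p 0).1.
Hypothesis w_end : forall i p, V i p -> 0 < dot (w i p 1) (torus_pt p i).
Hypothesis w_per : forall i p p', torus_pt p =1 torus_pt p' -> w i p = w i p'.

(** At scale [e], neighbouring samples of the paths of neighbouring points form angles of less than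
    a quarter turn, which [ang] measures correctly. *)
Definition winding_fine (i : 'I_m) (p : 'rV[R]_m) (e : R) :=
  forall q q' : 'rV[R]_m, ball p e q -> ball p e q' ->
  [/\ 0 < (w i q 0).1, 0 < dot (w i q 1) (torus_pt q' i) &
      forall t t', 0 <= t <= 1 -> `|t - t'| < e -> 0 < dot (w i q t) (w i q' t')].

Lemma torus_pt_continuous i : continuous (torus_pt ^~ i).
Proof.
move=> p; apply: cont_pair; [apply: cont_cos|apply: cont_sin].
  by apply: contM; [exact: cont_cst|exact: coord_continuous].
by apply: contM; [exact: cont_cst|exact: coord_continuous].
Qed.

Lemma winding_fine_near i p : V i p -> exists2 e, 0 < e & winding_fine i p e.
Proof.
move=> Vp.
have near1 : \forall q \near p, 0 < (w i q 0).1.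
  have c : {for p, continuous (fun q => (w i q 0).1)}.
    apply: cont_fst.
    apply: (@cont_comp _ _ _ (fun q : 'rV[R]_m => (q, 0 : R)) (fun z => w i z.1 z.2)).
      by apply: cont_pair; [exact: cont_id|exact: cont_cst].
    exact: w_cont.
  exact: (c _ (lt_nbhsr (w_start Vp))).
have near2 : \forall z \near (p, p), 0 < dot (w i z.1 1) (torus_pt z.2 i).
  have c : {for (p, p), continuous (fun z : 'rV[R]_m * 'rV[R]_m => dot (w i z.1 1) (torus_pt z.2 i))}.
    apply: continuous_dot.
      apply: (@cont_comp _ _ _ (fun q : 'rV[R]_m * 'rV[R]_m => (q.1, 1 : R)) (fun z => w i z.1 z.2)).
        by apply: cont_pair; [exact: cvg_fst|exact: cont_cst].
      exact: w_cont.
    apply: (@cont_comp _ _ _ snd (torus_pt ^~ i)); first exact: cvg_snd.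
    exact: torus_pt_continuous.
  exact: (c _ (lt_nbhsr (w_end Vp))).
have near3 : \forall e \near 0^'+, `[0, 1]%classic `<=` [set t : R |
    forall q q' t', ball p e q -> ball p e q' -> `|t - t'| < e ->
    0 < dot (w i q t) (w i q' t')].
  apply: (compact_near_coveringP _).1; first exact: segment_compact.
  move=> t _.
  have c : {for ((p, t), (p, t)), continuous (fun z : ('rV[R]_m * R) * ('rV[R]_m * R) =>
      dot (w i z.1.1 z.1.2) (w i z.2.1 z.2.2))}.
    apply: continuous_dot.
      apply: (@cont_comp _ _ _ fst (fun z => w i z.1 z.2)); first exact: cvg_fst.
      exact: w_cont.
    apply: (@cont_comp _ _ _ snd (fun z => w i z.1 z.2)); first exact: cvg_snd.
    exact: w_cont.
  have /c := lt_nbhsr (dot_self_gt0 (@w_neq0 i p t Vp)).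
  rewrite /= -nbhs_ballE => -[e /= e0 He]; have {}e0 : 0 < e := e0.
  near=> t1 e1 => q q' t' /= pq pq' tt'.
  have e1e : e1 < e / 2 by near: e1; apply: nbhs_right_lt; rewrite divr_gt0.
  have tt1 : `|t - t1| < e / 2.
    by near: t1; apply: (@nbhsx_ballx _ _ t); rewrite divr_gt0.
  apply: (He ((q, t1), (q', t'))); split; split => /=.
  - by apply: le_ball pq; lra.
  - by apply: lt_trans tt1 _; lra.
  - by apply: le_ball pq'; lra.
  - by rewrite /ball /= (le_lt_trans (ler_distD t1 _ _)) //; lra.
move: near1 near2 => /nbhs_ballP[e1 /= e10 H1] /nbhs_ballP[e2 /= e20 H2].
near (0:R)^'+ => e.
exists e => // q q' pq pq'; split.
- by apply: H1; apply: le_ball pq; near: e; exact: nbhs_right_le.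
- by apply: (H2 (q, q')); split; (apply: le_ball; last by [exact: pq|exact: pq']);
    near: e; exact: nbhs_right_le.
- move=> t t' t01 tt'.
  have : `[0, 1]%classic t by rewrite /= in_itv.
  move: t t01 tt' => /= t _ tt' t01.
  have := (near near3 e) => /(_ _ _ t01).
  by apply.
Unshelve. all: by end_near. Qed.

(** A Lebesgue number for the cover of the unit cube. The bound on [K] makes the edges of the grid
    shorter than a quarter turn. *)
Lemma winding_fine_uniform : exists2 K : nat, (4 <= K)%N &
  forall p : 'rV[R]_m, (forall j, 0 <= p ord0 j <= 1) ->
  exists i, winding_fine i p (2 / K.+1%:R).
Proof.
have cpt : compact [set p : 'rV[R]_m | forall j, `[0, 1]%classic (p ord0 j)].
  by apply: (@rV_compact R m (fun=> `[0, 1]%classic)) => _; exact: segment_compact.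
have : \forall K \near \oo, [set p : 'rV[R]_m | forall j, `[0, 1]%classic (p ord0 j)]
    `<=` [set p | exists i, winding_fine i p (2 / K.+1%:R)].
  apply: (compact_near_coveringP _).1; first exact: cpt.
  move=> p _.
  have [i /winding_fine_near[e e0 fine_e]] := Vcover p.
  have e40 : 0 < e / 4 by rewrite divr_gt0.
  near=> p1 K; exists i => q q' /=.
  have pp1 : ball p (e / 2) p1.
    by near: p1; apply: (@nbhsx_ballx _ _ p); rewrite divr_gt0.
  have Ke : 2 / K.+1%:R < e / 2.
    suff : K.+1%:R^-1 < e / 4 by move: (K.+1%:R^-1) => x ?; lra.
    by near: K; exact: (near_infty_natSinv_lt (PosNum e40)).
  have sub q1 : ball p1 (2 / K.+1%:R) q1 -> ball p e q1.
    move=> pq1; rewrite [e]splitr; apply: ball_triangle pp1 _.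
    by apply: le_ball pq1; exact: ltW.
  move=> /sub pq /sub pq'; have [H1 H2 H3] := fine_e q q' pq pq'; split => //.
  by move=> t t' t01 tt'; apply: H3 => //; apply: lt_trans tt' _; apply: lt_trans Ke _; lra.
move=> nK; near \oo => K; exists K; first by near: K; exact: nbhs_infty_ge.
move=> p p01.
by apply: (near nK K) => // j; rewrite /= in_itv p01.
Unshelve. all: by end_near. Qed.

(** Index 0 is the base point 1, the indices 1 to [M.+1] are the path at the times [0, 1/M, ..., 1],
    and index [M.+2] is the target point on the circle. *)
Definition sample M i p (k : nat) : C :=
  if k == 0%N then (1, 0) else
  if (k <= M.+1)%N then w i p (k.-1%:R / M%:R) else torus_pt p i.

Definition turns M i p : R :=
  (\sum_(k < M.+2) ang (sample M i p k) (sample M i p k.+1)) / (2 * pi).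

Lemma turns_per M i p p' : torus_pt p =1 torus_pt p' -> turns M i p = turns M i p'.
Proof.
by move=> pp'; rewrite /turns /sample (w_per i pp') pp'.
Qed.

(** [ang_sum] leaves only the angles between the ends: 0 at the common base point, and less than a
    quarter turn at the other end, where [ang_cis] computes it. *)
Lemma turns_diff M i p q q' : (0 < M)%N -> winding_fine i p (2 / M%:R) ->
  ball p (2 / M%:R) q -> ball p (2 / M%:R) q' ->
  `|q' ord0 i - q ord0 i| < 4^-1 ->
  turns M i q' - turns M i q = q' ord0 i - q ord0 i.
Proof.
move=> M0 fine_p pq pq' qq'.
have M0' : 0 < M%:R :> R by rewrite ltr0n.
have pi0 : 0 < pi :> R := pi_gt0 R.
have bnd : - (pi / 2) < 2 * pi * q' ord0 i - 2 * pi * q ord0 i < pi / 2.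
  move: qq'; rewrite ltr_norml => /andP[b1 b2]; rewrite -mulrBr; apply/andP; split; nra.
have next q1 q2 k : (k < M.+2)%N -> ball p (2 / M%:R) q1 -> ball p (2 / M%:R) q2 ->
    0 < dot (sample M i q1 k) (sample M i q2 k.+1).
  move=> kM pq1 pq2; have [H1 H2 H3] := fine_p _ _ pq1 pq2.
  have [H1' _ _] := fine_p _ _ pq2 pq1.
  rewrite /sample /=; case: k kM => [|k] /= kM.
    by rewrite /dot /= !mul0r mul1r addr0.
  rewrite ltnS in kM; rewrite kM; case: ltnP => kM'.
    apply: H3.
      by rewrite divr_ge0 //= ler_pdivrMr // mul1r ler_nat -ltnS.
    by rewrite -mulrBl -natr1 opprD addNKr normrM normrN1 mul1r gtr0_norm ?invr_gt0 // ltr_pMl ?invr_gt0 // ltr1n.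
  by rewrite (_ : k = M) ?divff ?lt0r_neq0 //; apply/eqP; rewrite eqn_leq -ltnS kM.
have same k : (k <= M.+2)%N -> 0 < dot (sample M i q k) (sample M i q' k).
  move=> kM; have [H1 H2 H3] := fine_p _ _ pq pq'.
  rewrite /sample; case: k kM => [|k] /= kM; first by rewrite /dot /= mulr1 mulr0 addr0.
  case: ifP => kM'; last by rewrite dot_cis cos_gt0_pihalf.
  apply: H3; last by rewrite subrr normr0 divr_gt0.
  by rewrite divr_ge0 //= ler_pdivrMr // mul1r ler_nat -ltnS.
have last q1 : sample M i q1 M.+2 = cis (2 * pi * q1 ord0 i).
  by rewrite /sample /= ltnn.
have := @ang_sum _ (sample M i q) (sample M i q') M.+2.
rewrite !last ang_cis // ang0 add0r => ang_eq.
rewrite /turns -mulrBl -ang_eq //; last by move=> k kM; split; exact: next.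
rewrite addrC addKr -mulrBr mulrAC divff ?mul1r //.
by rewrite mulf_neq0 ?lt0r_neq0.
Qed.

(** On the grid the functions [turns] are primitives of the coordinate forms, each on the cells
    where its paths are fine: this is what [torus_no_primitives] excludes. *)
Theorem winding_cover_false : False.
Proof.
have [K K4 fineK] := winding_fine_uniform; pose M := K.+1.
have M0 : 0 < M%:R :> R by rewrite ltr0n.
(* The corners of a cell are not reduced modulo [M], so that they stay close to its base point;
   [shift] identifies them with grid points on the torus. *)
pose gp (v : {ffun 'I_m -> 'I_K.+1}) (T : {set 'I_m}) : 'rV[R]_m :=
  \row_j ((v j + (j \in T))%:R / M%:R).
suff : forall v : {ffun 'I_m -> 'I_K.+1}, exists i, forall (T : {set 'I_m}) d, d \notin T ->
    dc (fun v => turns M i (gp v finset.set0)) (v + \sum_(j in T) step K j) d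
      = (d == i)%:R / K.+1%:R.
  exact: torus_no_primitives.
move=> v; have [|i fine_i] := fineK (gp v finset.set0).
  move=> j; rewrite mxE inE addn0 divr_ge0 //= ler_pdivrMr // mul1r ler_nat ltnW //.
exists i => T d dT.
have val_sum (S : {set 'I_m}) j :
    nat_of_ord ((v + \sum_(l in S) step K l) j) = ((v j + (j \in S)) %% M)%N.
  rewrite ffunE sum_ffunE.
  have [jS|jS] := boolP (j \in S).
    rewrite (bigD1 j) //= ffunE eqxx big1 ?addr0 => [|l /andP[_ /negPf lj]].
      by rewrite /= addn0 !modnDmr.
    by rewrite /step ffunE eq_sym lj.
  rewrite big1 => [|l lS]; first by rewrite addr0 addn0 modn_small.
  by rewrite /step ffunE; case: eqP => // jl; rewrite jl lS in jS.
have shift (S : {set 'I_m}) :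
    torus_pt (gp (v + \sum_(j in S) step K j) finset.set0) =1 torus_pt (gp v S).
  move=> j; rewrite /torus_pt !mxE inE addn0 val_sum.
  rewrite [in RHS](divn_eq (v j + (j \in S)) M) natrD natrM [X in _ = cis (_ * X)]mulrDl mulfK ?lt0r_neq0 //.
  rewrite -[in LHS](cis_periodic _ ((v j + (j \in S)) %/ M)); congr cis; ring.
have inball S : ball (gp v finset.set0) (2 / M%:R) (gp v S).
  split=> [|o j]; first by rewrite divr_gt0.
  rewrite (ord1 o) /ball /= !mxE inE addn0 natrD mulrDl opprD addNKr normrN.
  rewrite ger0_norm ?divr_ge0 // ltr_pdivrMr // divfK ?lt0r_neq0 //.
  by rewrite ltr_nat; case: (j \in S).
rewrite /dc -addrA [\sum_(j in T) step K j + _]addrC -big_setU1 //=.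
rewrite !(turns_per _ _ (shift _)).
have E : gp v (d |: T) ord0 i - gp v T ord0 i = (d == i)%:R / M%:R.
  rewrite !mxE !inE -mulrBl !natrD opprD addrACA subrr add0r eq_sym.
  by case: (eqVneq d i) => [<-|_] /=; rewrite ?(negPf dT) ?subr0 ?subrr.
rewrite (@turns_diff M i (gp v finset.set0)) // E.
rewrite ger0_norm ?divr_ge0 // ltr_pdivrMr //.
apply: (@le_lt_trans _ _ 1); first by case: (d == i).
by rewrite mulrC ltr_pdivlMr // mul1r ltr_nat.
Qed.

End WindingCover.

(** * Motion planners and homotopies *)

Lemma cont_set_type (T X : topologicalType) (A : set X) (f : T -> set_type A) x :
  {for x, continuous (fun y => set_val (f y))} -> {for x, continuous f}.
Proof.
move=> cf U [? /= [[W oW <-]]] /= Wsfz /filterS; apply; apply: cf.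
exact: open_nbhs_nbhs.
Qed.

Lemma cont_set_val (T X : topologicalType) (A : set X) (f : T -> set_type A) x :
  {for x, continuous f} -> {for x, continuous (fun y => set_val (f y))}.
Proof.
move=> cf; apply: cont_comp => //; exact: (@initial_continuous (set_type A) X set_val).
Qed.

Lemma cont_ptws (T V : topologicalType) (I : eqType) (f : T -> {ptws I -> V}) x :
  (forall i, {for x, continuous (fun y => f y i)}) -> {for x, continuous f}.
Proof.
move=> cf; apply/cvg_sup => i U [? /= [[W oW <-]]] /= Wsfz /filterS; apply.
by apply: cf; exact: open_nbhs_nbhs.
Qed.

Lemma cont_proj (T V : topologicalType) (I : eqType) (f : T -> {ptws I -> V}) i x :
  {for x, continuous f} -> {for x, continuous (fun y => f y i)}.
Proof.
move=> cf; apply: (@cont_comp _ {ptws I -> V} _ f (fun g => g i)) => //.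
exact: (@proj_continuous I (fun=> V)).
Qed.

Section Planner.
Variable R : realType.

Definition clamp (t : R) : R := Num.max 0 (Num.min 1 t).

Lemma clamp_itv t : 0 <= clamp t <= 1.
Proof. by rewrite le_max lexx /= ge_max ler01 ge_min lexx. Qed.

Lemma clamp_le0 t : t <= 0 -> clamp t = 0.
Proof. by move=> t0; rewrite /clamp min_r ?max_l // (le_trans t0). Qed.

Lemma clamp_ge1 t : 1 <= t -> clamp t = 1.
Proof. by move=> t1; rewrite /clamp min_l ?max_r. Qed.

Lemma cont_clamp (T : topologicalType) (f : T -> R) x : {for x, continuous f} ->
  {for x, continuous (fun y => clamp (f y))}.
Proof.
by move=> cf; apply: cont_max; [exact: cont_cst|apply: cont_min => //; exact: cont_cst].
Qed.

Lemma clampP t : clamp t \in (`[0, 1]%classic : set R).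
Proof. by rewrite inE /= in_itv /= clamp_itv. Qed.

Definition uclamp t : unit_interval R := exist _ (clamp t) (clampP t).

Lemma uclamp_continuous : continuous uclamp.
Proof. by move=> t; apply: cont_set_type; apply: cont_clamp; exact: cont_id. Qed.

Variable Y : topologicalType.

(** Evaluation is jointly continuous for the compact-open topology because the interval is locally
    compact: a compact set of times around [t] is sent into [W] by all [s z'] with [z'] near [z]. *)
Lemma planner_eval_continuous (U : set (Y * Y))
    (s : Y * Y -> {compact-open, unit_interval R -> Y}) :
  open U -> {within U, continuous s} ->
  (forall z, U z -> continuous (s z : unit_interval R -> Y)) ->
  forall z t, U z -> {for (z, t), continuous (fun y : Y * Y * R => s y.1 (uclamp y.2))}.
Proof.
move=> oU cs csz z t Uz O; rewrite nbhsE => -[W [oW Wz WO]].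
have /nbhs_ballP[e /= e0 He] : nbhs t (fun t' => W (s z (uclamp t'))).
  have c : {for t, continuous (fun t' => s z (uclamp t'))}.
    by apply: cont_comp; [exact: uclamp_continuous|exact: csz].
  by apply: c; exact: open_nbhs_nbhs.
have {}e0 : 0 < e := e0.
pose K := uclamp @` `[t - e / 2, t + e / 2]%classic.
have cK : compact K.
  apply: continuous_compact; last exact: segment_compact.
  exact: continuous_subspaceT uclamp_continuous.
have csz' : {for z, continuous s}.
  by move: cs; rewrite (continuous_open_subspace _ oU); apply; rewrite inE.
have sK : s z @` K `<=` W.
  move=> _ [_ [t' /= t't <-] <-]; apply: He.
  by rewrite /ball /= distrC ltr_distl; move: t't; rewrite in_itv /= => /andP[] *; lra.
have n1 : \forall z' \near z, s z' @` K `<=` W.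
  exact: (csz' _ (open_nbhs_nbhs (conj (compact_open_open cK oW) sK))).
have n2 : \forall y \near (z, t), `|t - y.2| < e / 2.
  by apply: (cvg_snd (nbhsx_ballx t _ _)); rewrite divr_gt0.
have n3 : \forall y \near (z, t), s y.1 @` K `<=` W by exact: (cvg_fst n1).
move: n3 n2; apply: filterS2 => y sub y2; apply: WO; apply: sub.
exists (uclamp y.2) => //; exists y.2 => //=.
by rewrite in_itv /=; move: y2; rewrite ltr_norml => /andP[] *; lra.
Qed.

(** In the other direction, the tube lemma turns joint continuity into continuity for the
    compact-open topology. *)
Lemma planner_of_homotopy (U : set (Y * Y)) (H : Y * Y -> R -> Y) :
  open U ->
  (forall z t, U z -> 0 <= t <= 1 ->
     {for (z, t), continuous (fun y : Y * Y * R => H y.1 y.2)}) ->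
  (forall z, U z -> H z 0 = z.1) -> (forall z, U z -> H z 1 = z.2) ->
  motion_planner R U.
Proof.
move=> oU cH H0 H1; exists (fun z (t : unit_interval R) => H z (set_val t)).
have itv (t : unit_interval R) : 0 <= set_val t <= 1.
  by have := set_valP t; rewrite /= in_itv.
split.
  rewrite continuous_open_subspace // => z; rewrite inE => Uz.
  apply/compact_open_cvgP => K O cK oO sub /=.
  suff : \forall z' \near z, K `<=` [set t | O (H z' (set_val t))].
    by apply: filterS => z' /= sub' _ [t Kt <-]; exact: sub'.
  move/compact_near_coveringP: cK => /(_ _ (nbhs z) (fun z' t => O (H z' (set_val t)))); apply.
  move=> t Kt.
  have c : {for (t, z), continuous (fun y : unit_interval R * (Y * Y) =>
      H y.2 (set_val y.1))}.
    apply: (@cont_comp _ _ _ (fun y : unit_interval R * (Y * Y) => (y.2, set_val y.1))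
      (fun y : Y * Y * R => H y.1 y.2)); last exact: cH.
    by apply: cont_pair; [exact: cvg_snd|apply: cont_set_val; exact: cvg_fst].
  by apply: c; apply: open_nbhs_nbhs; split => //; apply: sub; exists t.
move=> z Uz; split.
- move=> t; apply: (@cont_comp _ _ _ (fun t : unit_interval R => (z, set_val t))
    (fun y : Y * Y * R => H y.1 y.2)); last exact: cH.
  by apply: cont_pair; [exact: cont_cst|apply: cont_set_val; exact: cont_id].
- by move=> t ->; exact: H0.
- by move=> t ->; exact: H1.
Qed.

Lemma TC_le_mono k l : (k <= l)%N -> TC_le R Y k -> TC_le R Y l.
Proof.
move=> kl [U [HU cov]].
exists (fun i => if insub (i : nat) is Some j then U j else set0); split.
  move=> i; case: insubP => [j _ _|_]; first exact: HU.
  split; first exact: open0.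
  by apply: (@planner_of_homotopy _ (fun z _ => z.1)); [exact: open0| | |].
move=> z; have [j Uj] := cov z; exists (widen_ord kl j).
by rewrite (insubT (fun i => i < k)%N (ltn_ord j)) /= (_ : Sub _ _ = j) //; apply: val_inj.
Qed.

End Planner.

(** * Complex arithmetic in the plane *)

Section Plane.
Variable R : realType.
Local Notation C := (R * R)%type.
Implicit Types a b c : C.

Definition conjc a : C := (a.1, - a.2).
Definition scalec (s : R) a : C := (s * a.1, s * a.2).

Lemma dot_cis_self x : dot (cis x) (cis x) = 1 :> R.
Proof. by rewrite dot_cis subrr cos0. Qed.

Lemma dot_cmul a b : dot (cmul a b) (cmul a b) = dot a a * dot b b.
Proof. rewrite /dot /cmul /=; ring. Qed.

Lemma dot_scalec s a : dot (scalec s a) (scalec s a) = s ^+ 2 * dot a a.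
Proof. rewrite /dot /scalec /=; ring. Qed.

Lemma dot_eq0 a : dot a a = 0 -> a = (0, 0).
Proof.
case: a => x y /eqP; rewrite /dot /= -!expr2 paddr_eq0 ?sqr_ge0 // !sqrf_eq0.
by case/andP => /eqP-> /eqP->.
Qed.

Lemma cmul_neq0 a b : a <> (0, 0) -> b <> (0, 0) -> cmul a b <> (0, 0).
Proof.
move=> a0 b0 ab; have := mulr_gt0 (dot_self_gt0 a0) (dot_self_gt0 b0).
by rewrite -dot_cmul ab /dot /= mul0r addr0 ltxx.
Qed.

Lemma cmul_inj a b b' : a <> (0, 0) -> cmul a b = cmul a b' -> b = b'.
Proof.
move=> a0 E; have /dot_eq0 : dot (b - b') (b - b') = 0.
  have a0' := dot_self_gt0 a0.
  apply: (mulfI (lt0r_neq0 a0')); rewrite -dot_cmul mulr0.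
  have -> : cmul a (b - b') = cmul a b - cmul a b'.
    by rewrite /cmul /=; congr (_, _) => /=; ring.
  by rewrite E subrr /dot /= !mul0r addr0.
by rewrite -[(0, 0)]/(0 : C) => /eqP; rewrite subr_eq0 => /eqP.
Qed.

Lemma oppc_neq0 a : a <> (0, 0) -> - a <> (0, 0).
Proof.
move=> a0 E; apply: a0; rewrite -[a]opprK E.
by rewrite -[(0, 0)]/(0 : C) oppr0.
Qed.

Lemma zeta_powE r k : zeta_pow R r k = cis (2 * pi * k%:R / r%:R).
Proof. by []. Qed.

Lemma zeta_pow_full r : (0 < r)%N -> zeta_pow R r r = (1, 0).
Proof.
move=> r0; rewrite zeta_powE mulfK ?pnatr_eq0 -?lt0n // -[2 * pi]add0r.
by rewrite -[2 * pi]mul1r mulr_natl (cis_periodic 0 1) /cis cos0 sin0.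
Qed.

Lemma cmul1 a : cmul (1, 0) a = a.
Proof. by case: a => x y; rewrite /cmul /= !mul1r !mul0r subr0 addr0. Qed.

Lemma cont_cmul (T : topologicalType) (f g : T -> C) x :
  {for x, continuous f} -> {for x, continuous g} ->
  {for x, continuous (fun y => cmul (f y) (g y))}.
Proof.
move=> cf cg; apply: cont_pair; [apply: contB|apply: contD]; apply: contM;
  first [exact: cont_fst | exact: cont_snd].
Qed.

Lemma cont_oppc (T : topologicalType) (f : T -> C) x : {for x, continuous f} ->
  {for x, continuous (fun y => - f y)}.
Proof.
by move=> cf; apply: cont_pair; apply: contN; first [exact: cont_fst|exact: cont_snd].
Qed.

Lemma cont_scalec (T : topologicalType) (s : T -> R) (f : T -> C) x :
  {for x, continuous s} -> {for x, continuous f} ->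
  {for x, continuous (fun y => scalec (s y) (f y))}.
Proof.
move=> cs cf; apply: cont_pair; apply: contM.
- exact: cs.
- exact: cont_fst.
- exact: cs.
- exact: cont_snd.
Qed.

Lemma cont_addc (T : topologicalType) (f g : T -> C) x :
  {for x, continuous f} -> {for x, continuous g} ->
  {for x, continuous (fun y => f y + g y)}.
Proof.
by move=> cf cg; apply: cont_pair; apply: contD; first [exact: cont_fst|exact: cont_snd].
Qed.

Lemma cont_subc (T : topologicalType) (f g : T -> C) x :
  {for x, continuous f} -> {for x, continuous g} ->
  {for x, continuous (fun y => f y - g y)}.
Proof.
by move=> cf cg; apply: cont_pair; apply: contB; first [exact: cont_fst|exact: cont_snd].
Qed.

End Plane.

(** * The lower bound *)

(** Applied to [1 - cos (2 * pi * k / r)], this bounds the nontrivial powers of [zeta] away from 1;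
    nonpositive values are skipped. *)
Lemma min_positive (R : realType) (f : nat -> R) r :
  exists2 e : R, 0 < e & forall k, (k <= r)%N -> 0 < f k -> e <= f k.
Proof.
elim: r => [|r [e e0 IH]].
  have [f0|f0] := boolP (0 < f 0%N).
    by exists (f 0%N) => // k; rewrite leqn0 => /eqP->.
  by exists 1 => // k; rewrite leqn0 => /eqP->; rewrite (negPf f0).
have [f0|f0] := boolP (0 < f r.+1); last first.
  exists e => // k; rewrite leq_eqVlt => /orP[/eqP->|]; first by rewrite (negPf f0).
  exact: IH.
exists (Num.min e (f r.+1)); first by rewrite lt_min e0.
move=> k; rewrite leq_eqVlt ge_min => /orP[/eqP->|kr fk]; first by rewrite lexx orbT.
by rewrite IH.
Qed.

Section LowerBound.
Variables (R : realType) (r N : nat).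
Hypothesis r0 : (0 < r)%N.
Local Notation n := N.+1.
Local Notation m := (n + N)%N.
Local Notation C := (R * R)%type.
Local Notation X := (orbit_conf_space R r n).
Local Notation tor := (@torus_pt R m).

(* [A] lets the points turn around the origin on concentric circles; [B] lets
   them turn on small circles around the first one. *)
Definition torusA (p : 'rV[R]_m) : {ptws 'I_n -> C} :=
  fun j => scalec j.+1%:R (tor p (lshift N j)).

Definition torusB (e : R) (p : 'rV[R]_m) : {ptws 'I_n -> C} :=
  fun j => if unlift ord0 j is Some l
           then (1, 0) + scalec (e * l.+1%:R) (tor p (rshift n l)) else (1, 0).

Lemma torusA_in p : torusA p \in @orbit_conf R r n.
Proof.
have dA j : dot (torusA p j) (torusA p j) = j.+1%:R ^+ 2.
  by rewrite dot_scalec dot_cis_self mulr1.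
rewrite inE; split=> [i A0|i j ij k _ Aij].
  by have /esym/eqP := dA i; rewrite A0 /dot /= mul0r addr0 sqrf_eq0 pnatr_eq0.
have := dA j; rewrite Aij dot_cmul dA zeta_powE dot_cis_self mul1r => /eqP.
rewrite eqrXn2 // eqr_nat eqSS => /eqP ij'.
by apply: ij; exact: val_inj.
Qed.

(** For trivial powers of [zeta] the points are separated by their distances from 1; the other
    powers move the small disc around 1 that contains all the points off itself. *)
Lemma torusB_in : exists2 e : R, 0 < e < (n%:R)^-1 &
  forall p, torusB e p \in @orbit_conf R r n.
Proof.
have [d d0 Hd] := min_positive (fun k => 1 - cos (2 * pi * k%:R / r%:R) : R) r.
(* A coincidence of real parts would give [1 - cos <= 3 * e * n], which a quarter of [d]
   contradicts; the minimum with 1 keeps the points away from the origin. *)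
pose e := Num.min d 1 / (4 * n%:R).
have n0 : 0 < n%:R :> R by rewrite ltr0n.
have e0 : 0 < e by rewrite divr_gt0 ?lt_min ?d0 //= mulr_gt0.
have en1 : e * n%:R <= d / 4.
  have -> : e * n%:R = Num.min d 1 / 4 by rewrite /e; field; rewrite lt0r_neq0.
  by rewrite ler_pM2r ?invr_gt0 // ge_min lexx.
have en2 : e * n%:R <= 1 / 4.
  have -> : e * n%:R = Num.min d 1 / 4 by rewrite /e; field; rewrite lt0r_neq0.
  by rewrite ler_pM2r ?invr_gt0 // ge_min lexx orbT.
exists e.
  rewrite e0 -[ltRHS]mul1r ltr_pdivlMr //; lra.
move=> p.
pose rad (j : 'I_n) : R := e * j%:R.
have rad_n j : 0 <= rad j <= e * n%:R.
  by rewrite /rad mulr_ge0 ?(ltW e0) //= ler_pM2l // ler_nat ltnW.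
have Bform (j : 'I_n) : exists x, torusB e p j = (1, 0) + scalec (rad j) (cis x).
  rewrite /torusB; case: unliftP => [l ->|->].
    by exists (2 * pi * p ord0 (rshift n l)).
  by exists 0; rewrite /rad mulr0 /scalec /= !mul0r -[(0, 0)]/(0 : C) addr0.
have B1 j : 1 - rad j <= (torusB e p j).1.
  have [x ->] := Bform j; have := rad_n j; have := cos_geN1 x.
  rewrite /= => ? /andP[? _]; nra.
rewrite inE; split=> [i B0|i j ij k /andP[k1 kr] Bij].
  by have := B1 i; rewrite B0 /=; have /andP[] := rad_n i; lra.
have [zk|zk] := eqVneq (cos (2 * pi * k%:R / r%:R) : R) 1.
  have sk : sin (2 * pi * k%:R / r%:R) = 0 :> R by apply: cos1sin0; rewrite zk normr1.
  move: Bij; rewrite zeta_powE /cis zk sk cmul1.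
  have [x ->] := Bform j; have [y ->] := Bform i => /addrI E.
  have := dot_scalec (rad j) (cis x); rewrite E dot_scalec !dot_cis_self !mulr1.
  move/eqP; rewrite eqrXn2 //; [|by case/andP: (rad_n i)|by case/andP: (rad_n j)].
  rewrite /rad (inj_eq (mulfI _)) ?lt0r_neq0 // eqr_nat => /eqP ij'.
  by apply: ij; exact: val_inj.
have /Hd - /(_ kr) : 0 < 1 - cos (2 * pi * k%:R / r%:R) :> R.
  by rewrite subr_gt0 lt_neqAle zk cos_le1.
have := B1 j; rewrite Bij zeta_powE /cmul /=.
have [x ->] := Bform i => /=.
have /andP[i0 i1] := rad_n i; have /andP[j0 j1] := rad_n j.
have := cos_le1 x; have := cos_geN1 x; have := sin_le1 x; have := sin_geN1 x.
move: i0 i1 j0 j1 en1 en2 d0.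
have := cos_le1 (2 * pi * k%:R / r%:R : R); have := cos_geN1 (2 * pi * k%:R / r%:R : R).
have := sin_le1 (2 * pi * k%:R / r%:R : R); have := sin_geN1 (2 * pi * k%:R / r%:R : R).
move: (cos (2 * pi * k%:R / r%:R)) (sin (2 * pi * k%:R / r%:R)) (cos x) (sin x) (rad i) (rad j) (e * n%:R).
move=> c s c' s' a b t s1 s2 c1 c2 a0 at' b0 bt t1 t2 d0 s'1 s'2 c'1 c'2 H1 H2.
have : c * c' - s * s' <= 2 by nra.
nra.
Qed.

Definition coordX (x : X) (j : 'I_n) : C := (set_val x : {ptws 'I_n -> C}) j.

Lemma coordXE (x : {ptws 'I_n -> C}) (xin : x \in @orbit_conf R r n) j :
  coordX (exist _ x xin) j = x j.
Proof. by []. Qed.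

Lemma coordX_neq0 x j : coordX x j <> (0, 0).
Proof. by have [H _] := set_valP x; exact: H. Qed.

Lemma coordX_inj x i j : i <> j -> coordX x i <> coordX x j.
Proof.
move=> ij E; have [_ H] := set_valP x; have ji : j <> i by move/esym.
by apply: (H j i ji r); rewrite ?r0 ?leqnn // zeta_pow_full // cmul1.
Qed.

Lemma cont_coordX (T : topologicalType) (f : T -> X) j x : {for x, continuous f} ->
  {for x, continuous (fun y => coordX (f y) j)}.
Proof.
move=> cf; apply: (@cont_proj _ _ _ (fun y => set_val (f y) : {ptws 'I_n -> C})).
exact: cont_set_val.
Qed.

(* Nonvanishing functions on X; the second kind, equivalent in cohomology to
   (x_l - x_0) / x_l, is trivial along [A]. *)
Definition unitX (i : 'I_m) (x : X) : C :=
  match fintype.split i with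
  | inl j => coordX x j
  | inr l => cmul (coordX x (lift ord0 l) - coordX x ord0) (conjc (coordX x (lift ord0 l)))
  end.

Lemma unitX_neq0 i x : unitX i x <> (0, 0).
Proof.
rewrite /unitX; case: fintype.split => [j|l]; first exact: coordX_neq0.
apply: cmul_neq0.
  by move/eqP; rewrite -[(0, 0)]/(0 : C) subr_eq0 => /eqP; apply: coordX_inj.
have := @coordX_neq0 x (lift ord0 l); case: (coordX _ _) => a b /= ab0 [a0 b0].
by apply: ab0; rewrite a0 -[b]opprK b0 oppr0.
Qed.

Lemma cont_unitX (T : topologicalType) (f : T -> X) i x : {for x, continuous f} ->
  {for x, continuous (fun y => unitX i (f y))}.
Proof.
move=> cf; rewrite /unitX; case: fintype.split => [j|l]; first exact: cont_coordX.
apply: cont_cmul; first by apply: cont_subc; exact: cont_coordX.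
apply: cont_pair; [apply: cont_fst|apply: contN; apply: cont_snd]; exact: cont_coordX.
Qed.

(** Along the torus of pairs, [unitX i] of a planned path joins a value whose direction turns with
    the [i]-th coordinate to one in the right half-plane, which [winding_cover_false] excludes for a
    cover by [m] sets. *)
Theorem lower_bound : ~ TC_le R X m.
Proof.
move=> [U [HU cov]].
have [e /andP[e0 en] Bin] := torusB_in.
have e1 : e * n%:R < 1 by rewrite -ltr_pdivlMr ?ltr0n // mul1r.
have el (l : 'I_N) : e * l.+1%:R < 1.
  by apply: le_lt_trans e1; rewrite ler_pM2l // ler_nat ltnS ltnW.
pose G (p : 'rV[R]_m) : X * X :=
  (exist _ (torusA p) (torusA_in p), exist _ (torusB e p) (Bin p)).
have cG : continuous G.
  move=> p; apply: cont_pair; apply: cont_set_type; apply: cont_ptws => j.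
    by apply: cont_scalec; [exact: cont_cst|exact: torus_pt_continuous].
  change {for p, continuous (fun y => torusB e y j)}; rewrite /torusB.
  case: (unlift ord0 j) => [l|]; last exact: cont_cst.
  apply: cont_addc; first exact: cont_cst.
  by apply: cont_scalec; [exact: cont_cst|exact: torus_pt_continuous].
have [s Hs] := choice (fun i => (HU i).2).
pose ev i p t : X := s i (G p) (uclamp t).
(* The first [n] classes turn at the start of the path, on [A], and the others at its end, on [B];
   time is reversed for the former, so that every [w] finishes at the turning end. *)
pose w i p t : C := unitX i (ev i p (if fintype.split i is inl _ then 1 - t else t)).
apply: (@winding_cover_false R m (fun i p => U i (G p)) w).
- by move=> p; exact: cov.
- move=> i p t Up; apply: cont_unitX.
  pose tau (t : R) := if fintype.split i is inl _ then 1 - t else t.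
  apply: (@cont_comp _ _ _ (fun y : 'rV[R]_m * R => (G y.1, tau y.2))
     (fun y : (X * X) * R => s i y.1 (uclamp y.2))).
    apply: cont_pair.
      by apply: (@cont_comp _ _ _ fst G); [exact: cvg_fst|exact: cG].
    apply: (@cont_comp _ _ _ snd tau); first exact: cvg_snd.
    rewrite /tau; case: fintype.split => _; last exact: cont_id.
    by apply: contB; [exact: cont_cst|exact: cont_id].
  have [c H] := Hs i; apply: (@planner_eval_continuous _ _ (U i)) => //.
    exact: (HU i).1.
  by move=> z Uz; have [] := H z Uz.
- by move=> i p t _; exact: unitX_neq0.
- move=> i p Up; have [_ /(_ _ Up)[_ s0 s1]] := Hs i.
  rewrite /w /ev /unitX; case: fintype.splitP => [j|l] ij.
    rewrite s1 /=; last by apply: clamp_ge1; rewrite subr0.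
    rewrite !coordXE /torusB; case: (unlift ord0 j) => [l|] //=.
    have := cos_geN1 (2 * pi * p ord0 (rshift n l)); have := el l.
    have : 0 < e * l.+1%:R by rewrite mulr_gt0.
    move: (e * _) (cos _) => a c *; nra.
  (* On [A] the point [x_0] has modulus 1, less than that of [x_l], so [x_l - x_0] times the
     conjugate of [x_l] has positive real part. *)
  rewrite s0 /=; last by apply: clamp_le0.
  set x := 2 * pi * _; set y := 2 * pi * _.
  have := cosB x y; have := cos_le1 (x - y); have := cos2Dsin2 x.
  rewrite /bump /= add1n -[l.+2%:R]natr1.
  have : 1 <= l.+1%:R :> R by rewrite ler1n.
  move: (l.+1%:R) (cos x) (sin x) (cos y) (sin y) (cos (x - y)).
  move=> L c s' c' d f L1 cs f1 fE.
  rewrite [ltRHS](_ : _ = (L + 1) ^+ 2 * (c ^+ 2 + s' ^+ 2) - (L + 1) * (c * c' + s' * d));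
    last by ring.
  rewrite cs -fE; nra.
- move=> i p Up; have [_ /(_ _ Up)[_ s0 s1]] := Hs i.
  rewrite /w /ev /unitX; case: splitP => [j|l] ij.
    rewrite s0 /=; last by apply: clamp_le0; rewrite subrr.
    have -> : i = lshift N j by exact: val_inj.
    have := dot_cis_self (2 * pi * p ord0 (lshift N j)).
    rewrite !coordXE /torusA /torus_pt /scalec /dot /=.
    have : 0 < j.+1%:R :> R by rewrite ltr0n.
    move: (cos _) (sin _) (j.+1%:R) => c d L L0 E; nra.
  rewrite s1 /=; last by apply: clamp_ge1.
  have -> : i = rshift n l by exact: val_inj.
  rewrite !coordXE /torusB liftK unlift_none.
  have := cos2Dsin2 (2 * pi * p ord0 (rshift n l)).
  have := cos_geN1 (2 * pi * p ord0 (rshift n l)).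
  rewrite /torus_pt /scalec /cis /dot /=.
  have := el l; have : 0 < e * l.+1%:R by rewrite mulr_gt0.
  move: (e * _) (cos _) (sin _) => a c d a0 a1 c1 cd.
  (* The difference points in the direction of the coordinate, and the other factor has real part
     [1 + a * c], positive since [a < 1]. *)
  have pos : 0 < a * (1 + a * c) by nra.
  rewrite [ltRHS](_ : _ = (c ^+ 2 + d ^+ 2) * (a * (1 + a * c))); last by ring.
  by rewrite cd mul1r.
- move=> i p p' pp'; rewrite /w /ev (_ : G p = G p') //.
  congr (_, _); apply: eq_exist; apply/funext => j.
    by rewrite /torusA pp'.
  by rewrite /torusB; case: (unlift ord0 j) => // l; rewrite pp'.
Qed.

End LowerBound.

(** * Motion planners from a stratification *)

Lemma cont_near_eq (T U : topologicalType) (f g : T -> U) x :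
  (\forall y \near x, f y = g y) -> {for x, continuous f} -> {for x, continuous g}.
Proof.
move=> fg cf W; rewrite -(nbhs_singleton fg) => /cf; rewrite /nbhs /=.
by move: fg; apply: filterS2 => y /= ->.
Qed.

Section Strata.
Variables (R : realType) (Y : topologicalType).

Lemma planner_sub (U V : set (Y * Y)) : U `<=` V ->
  motion_planner R V -> motion_planner R U.
Proof.
move=> UV [s [cs Hs]]; exists s; split=> [|z /UV]; last exact: Hs.
exact: continuous_subspaceW cs.
Qed.

Lemma planner_bigcup (I : Type) (U : I -> set (Y * Y)) :
  (forall i, open (U i)) -> (forall i, motion_planner R (U i)) ->
  (forall i j z, U i z -> U j z -> i = j) ->
  motion_planner R (\bigcup_i U i).
Proof.
move=> oU pU dU; have [s Hs] := choice pU.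
pose s' (z : Y * Y) : {compact-open, unit_interval R -> Y} :=
  if pselect (exists i, U i z) is left p then s (projT1 (cid p)) z else fun=> z.1.
have s'E i z : U i z -> s' z = s i z.
  move=> Uz; rewrite /s'; case: pselect => [p|[]]; last by exists i.
  by case: cid => j Uj /=; rewrite (dU _ _ _ Uj Uz).
exists s'; split=> [|z [i _ Uz]]; last by rewrite (s'E i) //; exact: (Hs i).2.
rewrite continuous_open_subspace; last exact: bigcup_open.
move=> z; rewrite inE => -[i _ Uz]; apply: (@cont_near_eq _ _ (s i)).
  by apply: filterS (open_nbhs_nbhs (conj (oU i) Uz)) => y Uy; rewrite (s'E i).
have [cs _] := Hs i; move: cs; rewrite (continuous_open_subspace _ (oU i)).
by apply; rewrite inE.
Qed.

End Strata.

(* Cells of equal index are separated, so half-radius balls around their points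
   give disjoint neighbourhoods. That Y is pseudometric is expressed by an equation,
   because comparing the two structures inside [TC_le] is prohibitively slow. *)
Lemma TC_le_strata (R : realType) (M : pseudoMetricType R) (Y : topologicalType)
    (F : Type) (m : nat) (tau : Y * Y -> F) (idx : Y * Y -> nat) :
  (M : topologicalType) = Y ->
  (forall z, (idx z < m)%N) ->
  (forall z0, \forall z \near z0, idx z = idx z0 -> tau z = tau z0) ->
  (forall z0, exists U, [/\ open U, motion_planner R U &
     forall z, tau z = tau z0 -> U z]) ->
  TC_le R Y m.
Proof.
move=> MY; case: Y / MY in tau idx *; move=> idx_m sep plan.
have /choice[d Hd] : forall z0 : M * M, exists d : R, 0 < d /\
    forall z, ball z0 d z -> idx z = idx z0 -> tau z = tau z0.
  by move=> z0; have /nbhs_ballP[e e0 He] := sep z0; exists e; split => // z /He.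
pose cell k c := [set z | idx z = k /\ tau z = c].
have [U HU] : exists U : nat -> F -> set (M * M), forall k c,
    [/\ open (U k c), motion_planner R (U k c) & cell k c `<=` U k c].
  have /choice[U HU] : forall kc : nat * F, exists U, [/\ open U, motion_planner R U &
      cell kc.1 kc.2 `<=` U].
    move=> [k c] /=; have [[z0 [k0 c0]]|no] := pselect (exists z0, cell k c z0).
      have [U [oU pU HU]] := plan z0; exists U; split => // z [_ zc].
      by apply: HU; rewrite zc c0.
    exists set0; split; first exact: open0.
      by apply: (@planner_of_homotopy _ _ _ (fun z _ => z.1)); [exact: open0| | |].
    by move=> z zc; apply: no; exists z.
  by exists (fun k c => U (k, c)) => k c; exact: (HU (k, c)).
pose B k c := \bigcup_(z in cell k c) (ball z (d z / 2))^°.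
have oB k c : open (B k c) by apply: bigcup_open => z _; exact: open_interior.
have cB k c : cell k c `<=` B k c.
  move=> z zc; exists z => //; apply: nbhsx_ballx; rewrite divr_gt0 //.
  exact: (Hd z).1.
have dB k c c' z : B k c z -> B k c' z -> c = c'.
  move=> [z1 [k1 c1] /interior_subset b1] [z2 [k2 c2] /interior_subset b2].
  rewrite -c1 -c2; have [d12|d21] := leP (d z1) (d z2).
    apply: (Hd z2).2; last by rewrite k1 k2.
    rewrite [d z2]splitr; apply: ball_triangle b2 _; apply: ball_sym.
    by apply: le_ball b1; rewrite ler_pM2r.
  apply/esym; apply: (Hd z1).2; last by rewrite k1 k2.
  rewrite [d z1]splitr; apply: ball_triangle b1 _; apply: ball_sym.
  by apply: le_ball b2; rewrite ler_pM2r // ltW.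
exists (fun k : 'I_m => \bigcup_c (U k c `&` B k c)); split=> [k|z].
  have oUB c : open (U k c `&` B k c) by apply: openI => //; have [] := HU k c.
  split; first exact: bigcup_open.
  apply: planner_bigcup => //; last by move=> c c' z [_ b1] [_ b2]; exact: (dB k c c' z).
  by move=> c; have [_ + _] := HU k c; apply: planner_sub; exact: subIsetl.
exists (Ordinal (idx_m z)); exists (tau z) => //=.
by split; [have [_ _] := HU (idx z) (tau z); apply|exact: cB].
Qed.

(** * Homotopies of configurations *)

Section Homotopy.
Variables (R : realType) (r N : nat).
Local Notation n := N.+1.
Local Notation C := (R * R)%type.
Local Notation conf := ('I_n -> C).
Local Notation X := (orbit_conf_space R r n).

Definition isconf (c : conf) := orbit_conf r (c : {ptws 'I_n -> C}).

(** Homotopies take values in all [n]-tuples, with membership in the configuration space as a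
    separate condition, so that they can be given by formulas in the coordinates. *)
Definition htp (T : topologicalType) (U : set T) (f g : T -> conf) :=
  exists H : T -> R -> conf,
  [/\ forall z t j, U z -> 0 <= t <= 1 ->
        {for (z, t), continuous (fun y : T * R => H y.1 y.2 j)},
      forall z t, U z -> 0 <= t <= 1 -> isconf (H z t),
      forall z j, U z -> H z 0 j = f z j &
      forall z j, U z -> H z 1 j = g z j].

Lemma htp_sub (T : topologicalType) (U V : set T) f g : U `<=` V -> htp V f g -> htp U f g.
Proof.
move=> UV [H [H1 H2 H3 H4]]; exists H; split.
- by move=> z t j /UV; exact: H1.
- by move=> z t /UV; exact: H2.
- by move=> z j /UV; exact: H3.
- by move=> z j /UV; exact: H4.
Qed.

Lemma htp_comp (T T' : topologicalType) (p : T' -> T) (U : set T) f g :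
  continuous p -> htp U f g -> htp (p @^-1` U) (f \o p) (g \o p).
Proof.
move=> cp [H [H1 H2 H3 H4]]; exists (fun z => H (p z)); split.
- move=> z t j Uz t01.
  apply: (@cont_comp _ _ _ (fun y : T' * R => (p y.1, y.2)) (fun y : T * R => H y.1 y.2 j)).
    by apply: cont_pair; [apply: (@cont_comp _ _ _ fst p); [exact: cvg_fst|exact: cp]|exact: cvg_snd].
  exact: H1.
- by move=> z t; exact: H2.
- by move=> z j; exact: H3.
- by move=> z j; exact: H4.
Qed.

Lemma htp_sym (T : topologicalType) (U : set T) f g : htp U f g -> htp U g f.
Proof.
move=> [H [H1 H2 H3 H4]]; exists (fun z t => H z (1 - t)).
have rev (t : R) : 0 <= t <= 1 -> 0 <= 1 - t <= 1 by case/andP => *; apply/andP; split; lra.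
split.
- move=> z t j Uz t01.
  apply: (@cont_comp _ _ _ (fun y : T * R => (y.1, 1 - y.2)) (fun y : T * R => H y.1 y.2 j)).
    apply: cont_pair; first exact: cvg_fst.
    by apply: contB; [exact: cont_cst|exact: cvg_snd].
  by apply: H1 => //; exact: rev.
- by move=> z t Uz /rev; exact: H2.
- by move=> z j Uz; rewrite subr0 H4.
- by move=> z j Uz; rewrite subrr H3.
Qed.

(* The two halves are glued by a sum, of which one of the two summands is
   always equal to the subtracted midpoint. *)
Lemma htp_trans (T : topologicalType) (U : set T) f g h :
  htp U f g -> htp U g h -> htp U f h.
Proof.
move=> [H [H1 H2 H3 H4]] [K [K1 K2 K3 K4]].
exists (fun z t j => H z (clamp (2 * t)) j + K z (clamp (2 * t - 1)) j - H z 1 j).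
have i01 : 0 <= (1 : R) <= 1 by rewrite ler01 lexx.
split.
- move=> z t j Uz t01; apply: cont_subc; first apply: cont_addc.
  + apply: (@cont_comp _ _ _ (fun y : T * R => (y.1, clamp (2 * y.2))) (fun y : T * R => H y.1 y.2 j)).
      apply: cont_pair; first exact: cvg_fst.
      by apply: cont_clamp; apply: contM; [exact: cont_cst|exact: cvg_snd].
    by apply: H1 => //; exact: clamp_itv.
  + apply: (@cont_comp _ _ _ (fun y : T * R => (y.1, clamp (2 * y.2 - 1))) (fun y : T * R => K y.1 y.2 j)).
      apply: cont_pair; first exact: cvg_fst.
      apply: cont_clamp; apply: contB; last exact: cont_cst.
      by apply: contM; [exact: cont_cst|exact: cvg_snd].
    by apply: K1 => //; exact: clamp_itv.
  + apply: (@cont_comp _ _ _ (fun y : T * R => (y.1, 1 : R)) (fun y : T * R => H y.1 y.2 j)).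
      by apply: cont_pair; [exact: cvg_fst|exact: cont_cst].
    exact: H1.
- move=> z t Uz t01; have [t2|t2] := leP (2 * t) 1.
    rewrite [X in isconf X](_ : _ = H z (clamp (2 * t))).
      by apply: H2 => //; exact: clamp_itv.
    apply/funext => j; rewrite [clamp (2 * t - 1)]clamp_le0 ?subr_le0 //.
    by rewrite K3 // H4 // addrK.
  rewrite [X in isconf X](_ : _ = K z (clamp (2 * t - 1))).
    by apply: K2 => //; exact: clamp_itv.
  apply/funext => j; rewrite [clamp (2 * t)]clamp_ge1 ?ltW //.
  by rewrite addrC addKr.
- move=> z j Uz; rewrite mulr0 !clamp_le0 ?sub0r ?oppr_le0 //.
  by rewrite K3 // H4 // addrK H3.
- move=> z j Uz; rewrite mulr1 !clamp_ge1; [|lra|lra].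
  by rewrite addrC addKr K4.
Qed.

Definition segment (a b : C) (t : R) : C := scalec (1 - t) a + scalec t b.

Lemma segment0 a b : segment a b 0 = a.
Proof.
by case: a b => a1 a2 [b1 b2]; rewrite /segment /scalec /= subr0 !mul1r !mul0r;
  congr (_, _) => /=; rewrite addr0.
Qed.

Lemma segment1 a b : segment a b 1 = b.
Proof.
by case: a b => a1 a2 [b1 b2]; rewrite /segment /scalec /= subrr !mul1r !mul0r;
  congr (_, _) => /=; rewrite add0r.
Qed.

Lemma cont_segment (T : topologicalType) (f g : T -> C) (s : T -> R) x :
  {for x, continuous f} -> {for x, continuous g} -> {for x, continuous s} ->
  {for x, continuous (fun y => segment (f y) (g y) (s y))}.
Proof.
move=> cf cg cs; apply: cont_addc; apply: cont_scalec => //.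
by apply: contB => //; exact: cont_cst.
Qed.

Lemma htp_segment (T : topologicalType) (U : set T) f g :
  (forall z j, U z -> {for z, continuous (fun y => f y j)}) ->
  (forall z j, U z -> {for z, continuous (fun y => g y j)}) ->
  (forall z t, U z -> 0 <= t <= 1 -> isconf (fun j => segment (f z j) (g z j) t)) ->
  htp U f g.
Proof.
move=> cf cg Hc; exists (fun z t j => segment (f z j) (g z j) t); split => //.
- move=> z t j Uz t01; apply: cont_segment; last exact: cvg_snd.
    by apply: (@cont_comp _ _ _ fst (fun y => f y j)); [exact: cvg_fst|exact: cf].
  by apply: (@cont_comp _ _ _ fst (fun y => g y j)); [exact: cvg_fst|exact: cg].
- by move=> z j _; rewrite segment0.
- by move=> z j _; rewrite segment1.
Qed.

Lemma planner_of_htp (U : set (X * X)) : open U ->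
  htp U (fun z => coordX z.1) (fun z => coordX z.2) -> motion_planner R U.
Proof.
move=> oU [H [H1 H2 H3 H4]].
(* On [U] every value is a configuration, so the default [z.1] is never reached there. *)
pose K (z : X * X) (t : R) : X :=
  if pselect (isconf (H z (clamp t))) is left p
  then exist _ (H z (clamp t)) (mem_set p) else z.1.
have KE z t : U z -> set_val (K z t) = H z (clamp t).
  move=> Uz; rewrite /K; case: pselect => // -[]; apply: H2 => //; exact: clamp_itv.
apply: (@planner_of_homotopy _ _ U K) => //.
- move=> z t Uz t01; apply: cont_set_type; apply: cont_ptws => j.
  apply: (@cont_near_eq _ _ (fun y : X * X * R => H y.1 (clamp y.2) j)).
    have : \forall y \near (z, t), U y.1 by exact: (cvg_fst (open_nbhs_nbhs (conj oU Uz))).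
    by apply: filterS => y Uy; rewrite KE.
  apply: (@cont_comp _ _ _ (fun y : X * X * R => (y.1, clamp y.2)) (fun y : X * X * R => H y.1 y.2 j)).
    by apply: cont_pair; [exact: cvg_fst|apply: cont_clamp; exact: cvg_snd].
  by apply: H1 => //; exact: clamp_itv.
- move=> z Uz; apply: val_inj; apply/funext => j.
  change (set_val (K z 0) j = coordX z.1 j).
  by rewrite KE // clamp_le0 // H3.
- move=> z Uz; apply: val_inj; apply/funext => j.
  change (set_val (K z 1) j = coordX z.2 j).
  by rewrite KE // clamp_ge1 // H4.
Qed.

End Homotopy.

(** * Rays *)

Section Rays.
Variable R : realType.
Local Notation C := (R * R)%type.
Implicit Types a b c z : C.

Definition sameray a b := cross a b = 0 /\ 0 < dot a b.

Lemma dotC a b : dot a b = dot b a.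
Proof. by rewrite /dot mulrC [X in _ + X]mulrC. Qed.

Lemma sameray_sym a b : sameray a b -> sameray b a.
Proof.
move=> [cab dab]; split; last by rewrite dotC.
by rewrite -[RHS]oppr0 -cab /cross; ring.
Qed.

Lemma sameray_neq0 a b : sameray a b -> a <> (0, 0).
Proof. by move=> [_ +] a0; rewrite a0 /dot /= !mul0r addr0 ltxx. Qed.

Lemma sameray_refl a : a <> (0, 0) -> sameray a a.
Proof. by move=> /dot_self_gt0 a0; split => //; rewrite /cross mulrC subrr. Qed.

Lemma sameray_trans a b c : sameray a b -> sameray b c -> sameray a c.
Proof.
move=> ab bc; have bb := dot_self_gt0 (sameray_neq0 bc).
case: ab bc => cab dab [cbc dbc]; split.
  apply: (mulfI (lt0r_neq0 bb)); rewrite mulr0.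
  have -> : dot b b * cross a c = cross a b * dot b c + dot a b * cross b c.
    by rewrite /dot /cross; ring.
  by rewrite cab cbc mul0r mulr0 addr0.
rewrite -(pmulr_rgt0 _ bb).
have -> : dot b b * dot a c = dot a b * dot b c - cross a b * cross b c.
  by rewrite /dot /cross; ring.
by rewrite cab mul0r subr0 mulr_gt0.
Qed.

Lemma sameray_scale a (s : R) : a <> (0, 0) -> 0 < s -> sameray a (scalec s a).
Proof.
move=> /dot_self_gt0 a0 s0; split; first by rewrite /cross /scalec /=; ring.
have -> : dot a (scalec s a) = s * dot a a by rewrite /dot /scalec /=; ring.
exact: mulr_gt0.
Qed.

Lemma sameray_cmul z a b : z <> (0, 0) -> sameray a b -> sameray (cmul z a) (cmul z b).
Proof.
move=> /dot_self_gt0 z0 [cab dab]; split.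
  have -> : cross (cmul z a) (cmul z b) = dot z z * cross a b.
    by rewrite /cross /cmul /dot /=; ring.
  by rewrite cab mulr0.
have -> : dot (cmul z a) (cmul z b) = dot z z * dot a b.
  by rewrite /cmul /dot /=; ring.
exact: mulr_gt0.
Qed.

(** The case of equality in the Cauchy-Schwarz inequality, which makes the norm of [a - b]
    vanish. *)
Lemma sameray_norm a b : sameray a b -> dot a a = dot b b -> a = b.
Proof.
move=> ab E; have a0 := dot_self_gt0 (sameray_neq0 ab); case: ab => cab dab.
have H : dot a b * dot a b = dot a a * dot a a.
  have -> : dot a b * dot a b = dot a a * dot b b - cross a b * cross a b.
    by rewrite /dot /cross; ring.
  by rewrite cab mul0r subr0 -E.
have {}H : dot a b = dot a a.
  by apply/eqP; rewrite -(@eqrXn2 _ 2%N) ?ltW // !expr2 H.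
have /dot_eq0 : dot (a - b) (a - b) = 0.
  have -> : dot (a - b) (a - b) = dot a a - 2 * dot a b + dot b b by rewrite /dot /=; ring.
  by rewrite -E H; ring.
by rewrite -[(0, 0)]/(0 : C) => /eqP; rewrite subr_eq0 => /eqP.
Qed.

(** Nonzero vectors on different rays have nonzero [cross] or negative [dot], and both are open
    conditions. *)
Lemma near_notsameray (T : topologicalType) (f g : T -> C) x :
  {for x, continuous f} -> {for x, continuous g} -> f x <> (0, 0) -> g x <> (0, 0) ->
  ~ sameray (f x) (g x) -> \forall y \near x, ~ sameray (f y) (g y).
Proof.
move=> cf cg /dot_self_gt0 f0 /dot_self_gt0 g0 nfg.
have cc : {for x, continuous (fun y => cross (f y) (g y))}.
  by apply: contB; apply: contM; first [exact: cont_fst|exact: cont_snd].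
have [c0|c0] := eqVneq (cross (f x) (g x)) 0; last first.
  by have := cont_neq0 cc c0; apply: filterS => y /eqP c0' [].
have d0 : dot (f x) (g x) < 0.
  rewrite ltNge; apply/negP => d0; apply: nfg; split => //.
  rewrite lt_neqAle d0 andbT eq_sym; apply/eqP => d0'.
  have := mulr_gt0 f0 g0.
  have -> : dot (f x) (f x) * dot (g x) (g x)
     = dot (f x) (g x) * dot (f x) (g x) + cross (f x) (g x) * cross (f x) (g x).
    by rewrite /dot /cross; ring.
  by rewrite d0' c0 !mulr0 addr0 ltxx.
have cd : {for x, continuous (fun y => - dot (f y) (g y))}.
  by apply: contN; exact: continuous_dot.
have := cont_gt0 cd; rewrite oppr_gt0 => /(_ d0); apply: filterS => y.
by rewrite oppr_gt0 => d1 [_ d2]; have := lt_trans d1 d2; rewrite ltxx.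
Qed.

Lemma segment_neq0 a b (t : R) : a <> (0, 0) -> b <> (0, 0) ->
  ~ sameray a (- b) -> 0 <= t <= 1 -> segment a b t <> (0, 0).
Proof.
move=> a0 b0 nab /andP[t0 t1] E.
have [t00|t00] := eqVneq t 0; first by move: E; rewrite t00 segment0.
have [t11|t11] := eqVneq t 1; first by move: E; rewrite t11 segment1.
have {}t0 : 0 < t by rewrite lt_neqAle eq_sym t00.
have {}t1 : t < 1 by rewrite lt_neqAle t11.
apply: nab.
have -> : - b = scalec ((1 - t) / t) a; last first.
  by apply: sameray_scale => //; rewrite divr_gt0 // subr_gt0.
case: a b E {a0 b0} => a1 a2 [b1 b2] [/= E1 E2].
congr (_, _) => /=; apply: (mulfI (lt0r_neq0 t0)); rewrite mulrN.
  have -> : t * ((1 - t) / t * a1) = (1 - t) * a1 by field; rewrite lt0r_neq0.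
  by apply/eqP; rewrite eq_sym -addr_eq0 E1.
have -> : t * ((1 - t) / t * a2) = (1 - t) * a2 by field; rewrite lt0r_neq0.
by apply/eqP; rewrite eq_sym -addr_eq0 E2.
Qed.

Lemma cmulA a b c : cmul a (cmul b c) = cmul (cmul a b) c.
Proof. by rewrite /cmul /=; congr (_, _); ring. Qed.

Lemma cmulC a b : cmul a b = cmul b a.
Proof. by rewrite /cmul /=; congr (_, _); ring. Qed.

Lemma cmul_scalec a (s : R) b : cmul a (scalec s b) = scalec s (cmul a b).
Proof. by rewrite /cmul /scalec /=; congr (_, _); ring. Qed.

Lemma cmul_cis (x y : R) : cmul (cis x) (cis y) = cis (x + y).
Proof. by rewrite /cmul /cis cosD sinD /=; congr (_, _); ring. Qed.

End Rays.

(** * Powers of the root of unity *)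

Section Zeta.
Variables (R : realType) (r : nat).
Hypothesis r0 : (0 < r)%N.
Local Notation C := (R * R)%type.
Local Notation zeta := (zeta_pow R r).

Lemma rR0 : r%:R != 0 :> R.
Proof. by rewrite pnatr_eq0 -lt0n. Qed.

Lemma zetaD k l : zeta (k + l) = cmul (zeta k) (zeta l).
Proof.
by rewrite !zeta_powE cmul_cis; congr cis; rewrite natrD; field; exact: rR0.
Qed.

Lemma zeta0 : zeta 0 = (1, 0).
Proof. by rewrite zeta_powE mulr0 mul0r /cis cos0 sin0. Qed.

Lemma zeta_mod k : zeta (k %% r) = zeta k.
Proof.
rewrite {2}(divn_eq k r) zetaD (_ : zeta (_ * r) = (1, 0)) ?cmul1 //.
elim: (k %/ r)%N => [|q IH]; first by rewrite mul0n zeta0.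
by rewrite mulSn zetaD IH zeta_pow_full // cmul1.
Qed.

Lemma zeta_neq0 k : zeta k <> (0, 0).
Proof.
by move=> E; have := dot_cis_self (2 * pi * k%:R / r%:R : R); rewrite -zeta_powE E
  /dot /= mul0r addr0 => /esym/eqP; rewrite oner_eq0.
Qed.

Lemma zeta_inv k : zeta (k * r.-1 + k) = (1, 0).
Proof.
by rewrite -mulnSr prednK // -zeta_mod modnMl zeta0.
Qed.

Lemma dot_zeta k (a : C) : dot (cmul (zeta k) a) (cmul (zeta k) a) = dot a a.
Proof. by rewrite dot_cmul zeta_powE dot_cis_self mul1r. Qed.

End Zeta.

(** * Counting the classes of an equivalence relation *)

Section Redundancy.
Variable n : nat.
Implicit Types A B : 'I_n -> 'I_n -> Prop.

(** For an equivalence relation these are the elements that are not least in their class, so their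
    number is [n] minus the number of classes. *)
Definition redundant A : {set 'I_n} :=
  finset (fun i : 'I_n => `[< exists2 j : 'I_n, (j < i)%N & A j i >]).

Lemma redundantP A (i : 'I_n) : reflect (exists2 j : 'I_n, (j < i)%N & A j i) (i \in redundant A).
Proof. by rewrite finset.in_set; exact: asboolP. Qed.

Lemma redundantS A B : (forall i j, A i j -> B i j) -> redundant A \subset redundant B.
Proof.
move=> AB; apply/fintype.subsetP => i /redundantP[j ji Aji].
by apply/redundantP; exists j => //; exact: AB.
Qed.

Lemma least_related A (i : 'I_n) : (forall i, A i i) ->
  (forall i j k, A i j -> A j k -> A i k) ->
  exists2 j, A j i & j \notin redundant A.
Proof.
move=> Ar At; have [l] := ubnP (i : nat).
elim: l i => // l IH i il; have [|ri] := boolP (i \in redundant A); last by exists i.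
move=> /redundantP[j ji Aji]; have [|k Akj rk] := IH j.
  by apply: leq_trans ji _; rewrite -ltnS.
by exists k => //; exact: At Aji.
Qed.

(** A finer and a coarser equivalence relation with equally many classes have the same least
    representatives; representatives related by [B] then coincide, so the relations agree. *)
Lemma redundant_eq A B :
  (forall i, A i i) -> (forall i j, A i j -> A j i) ->
  (forall i j k, A i j -> A j k -> A i k) ->
  (forall i j, B i j -> B j i) -> (forall i j k, B i j -> B j k -> B i k) ->
  (forall i j, A i j -> B i j) -> #|redundant A| = #|redundant B| ->
  forall i j, B i j -> A i j.
Proof.
move=> Ar As At Bs Bt AB cAB.
have E : redundant A = redundant B.
  by apply/eqP; rewrite eqEcard redundantS //= cAB.
move=> i j Bij.
have [i' Ai' ri'] := least_related i Ar At; have [j' Aj' rj'] := least_related j Ar At.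
have Bij' : B i' j' by apply: Bt (AB _ _ Ai') (Bt _ _ _ Bij _); exact/Bs/AB.
suff ij' : i' = j' by apply: At (As _ _ Ai') _; rewrite ij'.
have [lt|lt|//] := ltngtP i' j'; last exact: val_inj.
  by move: rj'; rewrite E => /negP[]; apply/redundantP; exists i'.
by move: ri'; rewrite E => /negP[]; apply/redundantP; exists j' => //; exact: Bs.
Qed.

End Redundancy.

(** * Cells of the orbit configuration space *)

Section Cells.
Variables (R : realType) (r N : nat).
Hypothesis r0 : (0 < r)%N.
Local Notation n := N.+1.
Local Notation C := (R * R)%type.
Local Notation X := (orbit_conf_space R r n).
Local Notation zeta := (zeta_pow R r).
Local Notation sq a := (dot a a).
Implicit Types x : X.

Definition onray x k i j := sameray (cmul (zeta k) (coordX x i)) (coordX x j).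

Definition aligned x i j := exists k, onray x k i j.

Definition codim x := #|redundant (aligned x)|.

(** The order of the moduli is recorded only within alignment classes, since between unaligned
    points it may change inside a cell. *)
Definition cell_type x :=
  (onray x, fun i j => aligned x i j /\ sq (coordX x i) < sq (coordX x j)).

Lemma onray_mod x k i j : onray x (k %% r) i j = onray x k i j.
Proof. by rewrite /onray zeta_mod. Qed.

Lemma aligned_refl x i : aligned x i i.
Proof.
exists 0%N; rewrite /onray zeta0 cmul1; apply: sameray_refl; exact: coordX_neq0.
Qed.

Lemma onray_trans x k l i j h : onray x k i j -> onray x l j h -> onray x (l + k) i h.
Proof.
move=> kij ljh; rewrite /onray zetaD // -cmulA; apply: sameray_trans ljh.
by apply: sameray_cmul => //; exact: zeta_neq0.
Qed.

Lemma aligned_trans x i j h : aligned x i j -> aligned x j h -> aligned x i h.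
Proof. by move=> [k ij] [l jh]; exists (l + k)%N; exact: onray_trans ij jh. Qed.

Lemma aligned_sym x i j : aligned x i j -> aligned x j i.
Proof.
move=> [k ij]; exists (k * r.-1)%N; apply: sameray_sym.
have := sameray_cmul (@zeta_neq0 R r (k * r.-1)) ij.
by rewrite cmulA -zetaD // zeta_inv // cmul1.
Qed.

Lemma aligned_sq x i j : i <> j -> aligned x i j -> sq (coordX x i) <> sq (coordX x j).
Proof.
move=> ij [k kij] E.
have [_ /(_ i j ij)] := set_valP x.
(* The exponents in the definition of the configuration space run from 1 to [r], so the residue 0 is
   replaced by [r]. *)
have [k' k'r Ek] : exists2 k', (1 <= k' <= r)%N & zeta k' = zeta k.
  have [k0|k0] := posnP (k %% r)%N.
    by exists r; rewrite ?r0 ?leqnn // zeta_pow_full // -(zeta_mod R r0 k) k0 zeta0.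
  by exists (k %% r)%N; rewrite ?zeta_mod // k0 ltnW // ltn_pmod.
move=> /(_ k' k'r); apply; rewrite Ek; apply/esym; apply: sameray_norm kij _.
by rewrite dot_zeta.
Qed.

Lemma codim_le x : (codim x <= N)%N.
Proof.
apply: (@leq_trans #|[set~ (ord0 : 'I_n)]%SET|); last by rewrite cardsC1 card_ord.
apply: subset_leq_card; apply/fintype.subsetP => i /redundantP[j ji _]; rewrite !inE.
by apply/eqP => i0; rewrite i0 in ji.
Qed.

(** Alignment is a closed condition, and only the finitely many exponents below [r] have to be
    considered. *)
Lemma near_onray x0 : \forall x \near x0, forall k i j, onray x k i j -> onray x0 k i j.
Proof.
have H (kij : 'I_r * 'I_n * 'I_n) : \forall x \near x0,
    onray x kij.1.1 kij.1.2 kij.2 -> onray x0 kij.1.1 kij.1.2 kij.2.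
  case: kij => -[k i] j /=; have [on|off] := pselect (onray x0 k i j).
    by apply: filterS (@filterT _ (nbhs x0) _) => x _ _.
  have c1 : {for x0, continuous (fun x => cmul (zeta k) (coordX x i))}.
    by apply: cont_cmul; [exact: cont_cst|apply: cont_coordX; exact: cont_id].
  have c2 : {for x0, continuous (fun x => coordX x j)}.
    by apply: cont_coordX; exact: cont_id.
  have n1 : cmul (zeta k) (coordX x0 i) <> (0, 0).
    by apply: cmul_neq0; [exact: zeta_neq0|exact: coordX_neq0].
  have n2 : coordX x0 j <> (0, 0) by exact: coordX_neq0.
  by apply: filterS (near_notsameray c1 c2 n1 n2 off) => x off' /off'.
apply: filterS (filter_forall _ H) => x Hx k i j.
have := Hx (Ordinal (ltn_pmod k r0), i, j) => /=.
by rewrite !onray_mod.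
Qed.

Lemma near_sq x0 : \forall x \near x0, forall i j,
  sq (coordX x0 i) < sq (coordX x0 j) -> sq (coordX x i) < sq (coordX x j).
Proof.
have H (ij : 'I_n * 'I_n) : \forall x \near x0,
    sq (coordX x0 ij.1) < sq (coordX x0 ij.2) -> sq (coordX x ij.1) < sq (coordX x ij.2).
  case: ij => i j /=; have [lt|_] := boolP (_ < _); last by apply: filterS (@filterT _ (nbhs x0) _).
  have c : {for x0, continuous (fun x => sq (coordX x j) - sq (coordX x i))}.
    by apply: contB; apply: continuous_dot; apply: cont_coordX; exact: cont_id.
  have lt' : 0 < sq (coordX x0 j) - sq (coordX x0 i) by rewrite subr_gt0.
  by apply: filterS (cont_gt0 c lt') => x; rewrite subr_gt0.
apply: filterS (filter_forall _ H) => x Hx i j.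
exact: (Hx (i, j)).
Qed.

(** Alignments can only be lost nearby, so [codim] is upper semicontinuous; when it is unchanged,
    [redundant_eq] shows that none is lost. *)
Lemma near_cell_type x0 : \forall x \near x0,
  (codim x <= codim x0)%N /\ (codim x = codim x0 -> cell_type x = cell_type x0).
Proof.
apply: filterS2 (near_onray x0) (near_sq x0) => x Hray Hsq.
have sub i j : aligned x i j -> aligned x0 i j by move=> [k ij]; exists k; exact: Hray.
split; first exact: subset_leq_card (redundantS sub).
move=> cod; have sup := redundant_eq (@aligned_refl x) (@aligned_sym x)
  (@aligned_trans x) (@aligned_sym x0) (@aligned_trans x0) sub cod.
have al i j : aligned x i j = aligned x0 i j by apply/propext; split=> [/sub|/sup].
congr (_, _).
  apply/funext => k; apply/funext => i; apply/funext => j.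
  apply/propext; split=> [/Hray//|kij].
  have [k' k'ij] : aligned x i j by apply: sup; exists k.
  (* At [x0] both [k] and the exponent [k'] found at [x] put a multiple of the same point on the
     same ray, so the two powers of [zeta] agree. *)
  have kk' := sameray_trans kij (sameray_sym (Hray _ _ _ k'ij)).
  apply: sameray_trans k'ij.
  rewrite (_ : cmul (zeta k) _ = cmul (zeta k') (coordX x i)).
    by apply: sameray_refl; apply: cmul_neq0; [exact: zeta_neq0|exact: coordX_neq0].
  congr cmul; apply: (@cmul_inj _ (coordX x0 i)); first exact: coordX_neq0.
  rewrite ![cmul (coordX x0 i) _]cmulC.
  by apply: sameray_norm => //; rewrite !dot_zeta.
apply/funext => i; apply/funext => j; rewrite al.
apply/propext; split=> -[ij lt]; split => //; last exact: Hsq.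
have [//|lt'|eq] := ltgtP (sq (coordX x0 i)) (sq (coordX x0 j)).
  by have := lt_trans lt (Hsq _ _ lt'); rewrite ltxx.
have [eij|nij] := eqVneq i j; first by rewrite eij ltxx in lt.
by case: (aligned_sq (elimN eqP nij) ij eq).
Qed.

End Cells.

(** * Moduli, and a criterion for full turns *)

Section Norm.
Variable R : realType.
Local Notation C := (R * R)%type.
Implicit Types a b : C.

Definition nrm a : R := Num.sqrt (dot a a).

Lemma nrm_gt0 a : a <> (0, 0) -> 0 < nrm a.
Proof. by move=> /dot_self_gt0; rewrite sqrtr_gt0. Qed.

Lemma nrm_scalec (s : R) a : 0 <= s -> nrm (scalec s a) = s * nrm a.
Proof. by move=> s0; rewrite /nrm dot_scalec sqrtrM ?sqr_ge0 // sqrtr_sqr ger0_norm. Qed.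

Lemma dot_ge0 a : 0 <= dot a a.
Proof. by rewrite /dot -!expr2 addr_ge0 ?sqr_ge0. Qed.


Lemma cont_nrm (T : topologicalType) (f : T -> C) x : {for x, continuous f} ->
  {for x, continuous (fun y => nrm (f y))}.
Proof. by move=> cf; apply: cont_sqrt; exact: continuous_dot. Qed.

Lemma scalec_neq0 (s : R) a : 0 < s -> a <> (0, 0) -> scalec s a <> (0, 0).
Proof.
move=> s0 /dot_self_gt0 a0 E; have := dot_scalec s a.
rewrite E /dot /= mul0r addr0 => /esym/eqP; rewrite mulf_eq0 sqrf_eq0.
by rewrite !gt_eqF.
Qed.

Lemma scalecA (s t : R) a : scalec s (scalec t a) = scalec (s * t) a.
Proof. by rewrite /scalec /= !mulrA. Qed.

Lemma scale1c a : scalec 1 a = a.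
Proof. by case: a => x y; rewrite /scalec /= !mul1r. Qed.

Lemma segment_scalec a (s t : R) : segment a (scalec s a) t = scalec (1 - t + t * s) a.
Proof. by rewrite /segment /scalec; congr (_, _) => /=; ring. Qed.

Lemma dot_nrm a : dot a a = nrm a ^+ 2.
Proof. by rewrite sqr_sqrtr ?dot_ge0. Qed.

(** After reduction modulo [M], half the angle lies between 0 and [pi], the latter excluded, and has
    sine 0, so it is 0. *)
Lemma cos_eq1_dvdn (M q : nat) : (0 < M)%N ->
  cos (2 * pi * q%:R / M%:R : R) = 1 -> (M %| q)%N.
Proof.
move=> M0; have M0' : 0 < M%:R :> R by rewrite ltr0n.
have -> : cos (2 * pi * q%:R / M%:R : R) = cos (pi * (q %% M)%:R / M%:R *+ 2).
  have [+ _] := cis_periodic (pi * (q %% M)%:R / M%:R *+ 2 : R) (q %/ M).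
  move=> <-; rewrite {1}(divn_eq q M); congr cos.
  by rewrite natrD natrM; field; rewrite lt0r_neq0.
rewrite /dvdn; case: posnP => // q0; rewrite cos_mulr2n cos2sin2 => E.
have : 0 < sin (pi * (q %% M)%:R / M%:R : R).
  apply: sin_gt0_pi; rewrite divr_gt0 ?mulr_gt0 ?ltr0n ?pi_gt0 //=.
  by rewrite ltr_pdivrMr // ltr_pM2l ?pi_gt0 // ltr_nat ltn_pmod.
move: (sin _) E => s E s0; nra.
Qed.

End Norm.

(** * Deformation of a cell to a standard configuration *)

Section Moves.
Variables (R : realType) (r N : nat).
Hypothesis r0 : (0 < r)%N.
Local Notation n := N.+1.
Local Notation C := (R * R)%type.
Local Notation X := (orbit_conf_space R r n).
Local Notation zeta := (zeta_pow R r).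
Local Notation sq a := (dot a a).
Implicit Types x : X.

Lemma isconf_norms (c : 'I_n -> C) : (forall j, c j <> (0, 0)) ->
  (forall i j, i <> j -> sq (c i) <> sq (c j)) -> isconf r c.
Proof.
move=> c0 cd; split => // i j ij k _ E; apply: (cd _ _ ij).
by rewrite E dot_zeta.
Qed.

Lemma isconf_cmul (a : C) (c : 'I_n -> C) : a <> (0, 0) -> isconf r c ->
  isconf r (fun j => cmul a (c j)).
Proof.
move=> a0 [c0 cd]; split=> [i|i j ij k kr]; first exact: cmul_neq0.
by rewrite cmulA [cmul _ a]cmulC -cmulA => /(cmul_inj a0); exact: cd.
Qed.

(** The first [n] of the [r * n]-th roots of unity lie in one sector of angle [2 * pi / r], so that
    their orbits are disjoint. *)
Definition spread (j : 'I_n) : C := cis (2 * pi * j%:R / (r * n)%N%:R).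

(** An equality would make [j] congruent to [k * n + i] modulo [r * n], hence to [i] modulo [n]. *)
Lemma spread_distinct (i j : 'I_n) k : i <> j -> spread j <> cmul (zeta k) (spread i).
Proof.
move=> ij E; have rn0 : (0 < r * n)%N by rewrite muln_gt0 r0.
have rn0' : (r * n)%N%:R != 0 :> R by rewrite pnatr_eq0 -lt0n.
pose q := (k * n + i + (r * n - j))%N.
have jrn : (j <= r * n)%N by apply: leq_trans (ltnW (ltn_ord j)) _; rewrite leq_pmull.
have qE : (q + j = k * n + i + r * n)%N by rewrite /q -addnA subnK.
have : (r * n %| q)%N.
  apply: (@cos_eq1_dvdn R) => //.
  have := dot_cis_self (2 * pi * j%:R / (r * n)%N%:R : R).
  rewrite -/(spread j) {2}E /spread zeta_powE cmul_cis dot_cis => E1.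
  rewrite -[RHS]E1; set D := (X in _ = cos X).
  have [E2 _] := cis_periodic D 1; rewrite -E2; congr cos; rewrite /D.
  have -> : q%:R = k%:R * n%:R + i%:R + (r * n)%N%:R - j%:R :> R.
    by apply/eqP; rewrite eq_sym subr_eq -!natrM -!natrD eqr_nat qE.
  rewrite natrM in rn0' *; field.
  by rewrite addrC natr1 pnatr_eq0 rR0.
move/(dvdn_trans (dvdn_mull r (dvdnn n))) => nq; apply: ij; apply: val_inj => /=.
have : (q + j = k * n + i + r * n %[mod n])%N by rewrite qE.
rewrite -modnDml (eqP nq) add0n modn_small // -modnDmr modnMl addn0 -modnDml modnMl.
by rewrite add0n modn_small.
Qed.

Section Rank.
Variable w : 'I_n -> R.

(** Ties are broken by the index, so that [rank] separates all points besides respecting strict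
    inequalities. *)
Definition below i j := (w i < w j) || (w i == w j) && (i < j)%N.

Lemma below_trans : transitive below.
Proof.
move=> j i k; rewrite /below => /orP[ij|/andP[/eqP-> ij]] /orP[jk|/andP[/eqP <- jk]].
- by rewrite (lt_trans ij jk).
- by rewrite ij.
- by rewrite jk.
- by rewrite eqxx (ltn_trans ij jk) orbT.
Qed.

Definition rank j : R := #|finset (below ^~ j)|.+1%:R.

Lemma rank_gt0 j : 0 < rank j.
Proof. by rewrite ltr0n. Qed.

Lemma rank_below i j : below i j -> rank i < rank j.
Proof.
move=> ij; rewrite ltr_nat ltnS; apply: proper_card; apply/properP; split.
  by apply/fintype.subsetP => k; rewrite !finset.in_set => /below_trans; apply.
by exists i; rewrite finset.in_set // /below ltxx ltnn andbF.
Qed.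

Lemma rank_lt i j : w i < w j -> rank i < rank j.
Proof. by move=> ij; apply: rank_below; rewrite /below ij. Qed.

Lemma rank_neq i j : i <> j -> rank i <> rank j.
Proof.
move=> ij E; have : below i j || below j i.
  rewrite /below; case: ltgtP => //= _; case: ltngtP => // ij'.
  by case: ij; exact: val_inj.
by case/orP => /rank_below; rewrite E ltxx.
Qed.

End Rank.

(** The sign of the multiple of [x_0] towards which [x_j] will be turned, chosen so that on the cell
    [x_j] is never opposite to it. *)
Definition side x0 (j : 'I_n) : R := if `[< onray x0 0 ord0 j >] then 1 else - 1.

Definition radius x0 := rank (fun j => sq (coordX x0 j)).

(* Neighbourhood of the cell of [x0] on which the planner of that cell works. *)
Definition nbh x0 : set X := [set x | [/\
  forall i j, aligned x i j -> aligned x0 i j,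
  forall i j, aligned x0 i j -> sq (coordX x0 i) < sq (coordX x0 j) ->
              sq (coordX x i) < sq (coordX x j) &
  forall j, ~ sameray (coordX x j) (- scalec (side x0 j) (coordX x ord0))]].

Lemma side_coord_neq0 x0 j x : scalec (side x0 j) (coordX x ord0) <> (0, 0).
Proof.
rewrite /side; case: asboolP => _; first by rewrite scale1c; exact: coordX_neq0.
rewrite (_ : scalec _ _ = - coordX x ord0); first exact/oppc_neq0/coordX_neq0.
by case: (coordX _ _) => a b; rewrite /scalec /= !mulN1r.
Qed.

Lemma nbh_open x0 : open (nbh x0).
Proof.
rewrite openE => x [Nal Nsq Nside]; rewrite /interior.
have H j : \forall y \near x,
    ~ sameray (coordX y j) (- scalec (side x0 j) (coordX y ord0)).
  apply: near_notsameray.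
  - by apply: cont_coordX; exact: cont_id.
  - apply: cont_oppc; apply: cont_scalec; first exact: cont_cst.
    by apply: cont_coordX; exact: cont_id.
  - exact: coordX_neq0.
  - exact/oppc_neq0/side_coord_neq0.
  - exact: Nside.
apply: filterS2 (filterI (near_onray r0 x) (near_sq x)) (filter_forall _ H) => y [Hray Hsq] Hside.
split => //.
  by move=> i j [k kij]; apply: Nal; exists k; exact: Hray.
by move=> i j al lt; apply: Hsq; exact: Nsq.
Qed.

Lemma cell_nbh x0 x : cell_type x = cell_type x0 -> nbh x0 x.
Proof.
move=> [Eray Elt].
have al i j : aligned x i j = aligned x0 i j by rewrite /aligned Eray.
split.
- by move=> i j; rewrite al.
- move=> i j al0 lt; suff [] : aligned x i j /\ sq (coordX x i) < sq (coordX x j) by [].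
  by rewrite (congr1 (fun f => f i j) Elt).
- move=> j; rewrite /side -Eray; case: asboolP.
    rewrite /onray zeta0 cmul1 => -[_ d1]; rewrite scale1c => -[_].
    have -> : dot (coordX x j) (- coordX x ord0) = - dot (coordX x ord0) (coordX x j).
      by rewrite /dot /=; ring.
    by rewrite oppr_gt0 => d2; have := lt_trans d1 d2; rewrite ltxx.
  rewrite /onray zeta0 cmul1 => off on; apply: off; apply: sameray_sym.
  move: on; rewrite (_ : - scalec _ _ = coordX x ord0) //.
  by case: (coordX x ord0) => a b; rewrite /scalec; congr (_, _) => /=; rewrite mulN1r opprK.
Qed.

Lemma spread_norm j : sq (spread j) = 1.
Proof. exact: dot_cis_self. Qed.

Lemma isconf_spread (s : 'I_n -> R) : (forall j, 0 < s j) ->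
  isconf r (fun j => scalec (s j) (spread j)).
Proof.
move=> s0; split=> [i|i j ij k _].
  by apply: scalec_neq0 => // E; have := spread_norm i; rewrite E /dot /= mul0r addr0
    => /esym/eqP; rewrite oner_eq0.
move=> E; have : s j = s i.
  apply/eqP; rewrite -(@eqrXn2 _ 2%N) ?ltW //.
  have := dot_scalec (s j) (spread j).
  by rewrite E dot_zeta dot_scalec !spread_norm !mulr1 => ->.
move: E; rewrite cmul_scalec => /[swap] -> E.
apply: (@spread_distinct i j k ij).
by rewrite -[LHS]scale1c -[RHS]scale1c -(mulVf (lt0r_neq0 (s0 i))) -!scalecA E.
Qed.

(** Once this is done only the first point varies, and joining two configurations amounts to moving
    one nonzero complex number. *)
Lemma htp_to_spread x0 : htp r (nbh x0) (@coordX R r N)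
  (fun x j => cmul (coordX x ord0) (spread j)).
Proof.
pose lam := radius x0; have lam0 j : 0 < lam j by exact: rank_gt0.
have X0 x j : coordX x j <> (0, 0) by exact: coordX_neq0.
have nX0 x j : 0 < nrm (coordX x j) by exact: nrm_gt0.
have cX x j : {for x, continuous (fun y : X => coordX y j)}.
  by apply: cont_coordX; exact: cont_id.
pose dir x j := scalec (nrm (coordX x j))^-1 (coordX x j).
have cdir x j : {for x, continuous (fun y => dir y j)}.
  apply: cont_scalec => //; apply: contV; first exact: lt0r_neq0.
  exact: cont_nrm.
(* Directions are kept, so two points can only collide if they are aligned at [x], hence at [x0];
   the old and the new moduli are then in the same strict order, and so are their convex
   combinations. *)
have stage1 : htp r (nbh x0) (@coordX R r N)
    (fun x j => scalec (lam j * nrm (coordX x ord0)) (dir x j)).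
  apply: htp_segment => [x j _|x j _|x t Nx t01]; first exact: cX.
    by apply: cont_scalec => //; apply: contM; [exact: cont_cst|exact: cont_nrm].
  have [Nal Nsq _] := Nx; case/andP: t01 => t0 t1.
  pose mu j := 1 - t + t * (lam j * nrm (coordX x ord0) * (nrm (coordX x j))^-1).
  have mu0 j : 0 < mu j.
    have : 0 < lam j * nrm (coordX x ord0) * (nrm (coordX x j))^-1.
      by rewrite divr_gt0 ?mulr_gt0.
    by rewrite /mu; move: (_ * _^-1) => y y0; nra.
  have muE j : mu j * nrm (coordX x j)
      = (1 - t) * nrm (coordX x j) + t * (lam j * nrm (coordX x ord0)).
    by rewrite /mu; field; rewrite lt0r_neq0.
  rewrite (_ : (fun j => _) = (fun j => scalec (mu j) (coordX x j))); last first.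
    by apply/funext => j; rewrite /dir scalecA segment_scalec.
  split=> [i|i j ij k _ E]; first exact: scalec_neq0.
  have al : aligned x i j.
    exists k; rewrite /onray.
    have z0 : cmul (zeta k) (coordX x i) <> (0, 0).
      by apply: cmul_neq0 => //; exact: zeta_neq0.
    apply: sameray_trans (sameray_scale z0 (mu0 i)) _; rewrite -cmul_scalec -E.
    by apply: sameray_sym; exact: sameray_scale.
  have En : mu j * nrm (coordX x j) = mu i * nrm (coordX x i).
    rewrite -!nrm_scalec ?(ltW (mu0 _)) // E.
    by rewrite /nrm dot_zeta.
  have cmp i' j' : aligned x0 i' j' -> sq (coordX x0 i') < sq (coordX x0 j') ->
      mu i' * nrm (coordX x i') < mu j' * nrm (coordX x j').
    move=> al' lt'; have lx := Nsq _ _ al' lt'; have ll : lam i' < lam j' by exact: rank_lt.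
    have ln : nrm (coordX x i') < nrm (coordX x j').
      by rewrite /nrm ltr_sqrt // dot_self_gt0.
    have lm : lam i' * nrm (coordX x ord0) < lam j' * nrm (coordX x ord0).
      by rewrite ltr_pM2r.
    rewrite !muE; move: t1; rewrite le_eqVlt => /orP[/eqP->|t1].
      by rewrite subrr !mul0r !mul1r !add0r.
    by rewrite ltr_leD ?ltr_pM2l ?subr_gt0 // ler_wpM2l // ltW.
  have al0 := Nal _ _ al.
  have [lt|lt|eq] := ltgtP (sq (coordX x0 i)) (sq (coordX x0 j)).
  - by have := cmp _ _ al0 lt; rewrite En ltxx.
  - by have := cmp _ _ (aligned_sym r0 al0) lt; rewrite En ltxx.
  - exact: (aligned_sq r0 ij al0 eq).
have side2 j : side x0 j ^+ 2 = 1.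
  by rewrite /side; case: asboolP => _; rewrite ?sqrrN expr1n.
have ndir x j : nrm (dir x j) = 1.
  by rewrite nrm_scalec ?invr_ge0 ?ltW // mulVf // lt0r_neq0.
(* With distinct moduli the directions may move freely. Each follows the segment to plus or minus
   that of [x_0], which avoids 0 on [nbh x0]; dividing by the norm keeps the modulus fixed. *)
have stage2 : htp r (nbh x0)
    (fun x j => scalec (lam j * nrm (coordX x ord0)) (dir x j))
    (fun x j => scalec (lam j * side x0 j) (coordX x ord0)).
  pose d x t j := segment (dir x j) (scalec (side x0 j) (dir x ord0)) t.
  have d0 x t j : nbh x0 x -> 0 <= t <= 1 -> d x t j <> (0, 0).
    move=> [_ _ /(_ j) Nside]; apply: segment_neq0.
    - by apply: scalec_neq0; rewrite ?invr_gt0.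
    - rewrite /dir scalecA mulrC -scalecA; apply: scalec_neq0; first by rewrite invr_gt0.
      exact: side_coord_neq0.
    - move=> on; apply: Nside.
      apply: (sameray_trans (sameray_scale (s := (nrm (coordX x j))^-1) _ _)) => //.
        by rewrite invr_gt0.
      apply: (sameray_trans on); apply: sameray_sym.
      rewrite (_ : - scalec _ (dir x ord0) =
        scalec (nrm (coordX x ord0))^-1 (- scalec (side x0 j) (coordX x ord0))).
        apply: sameray_scale; last by rewrite invr_gt0.
        exact/oppc_neq0/side_coord_neq0.
      by rewrite /dir /scalec; congr (_, _) => /=; ring.
  have nd0 x t j : nbh x0 x -> 0 <= t <= 1 -> 0 < nrm (d x t j).
    by move=> Nx t01; apply: nrm_gt0; exact: d0.
  exists (fun x t j => scalec (lam j * nrm (coordX x ord0) * (nrm (d x t j))^-1) (d x t j)).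
  have cfst (x : X) (t : R) (f : X -> C) : {for x, continuous f} ->
      {for (x, t), continuous (fun y : X * R => f y.1)}.
    by move=> cf; apply: (@cont_comp _ _ _ fst f) => //; exact: cvg_fst.
  split.
  - move=> x t j Nx t01.
    have cd : {for (x, t), continuous (fun y : X * R => d y.1 y.2 j)}.
      apply: cont_segment; last exact: cvg_snd.
        exact: (cfst _ _ (fun y => dir y j)).
      apply: (cfst _ _ (fun y => scalec (side x0 j) (dir y ord0))).
      by apply: cont_scalec => //; exact: cont_cst.
    apply: cont_scalec => //; apply: contM.
      apply: contM; first exact: cont_cst.
      by apply: cont_nrm; exact: (cfst _ _ (fun y => coordX y ord0)).
    by apply: contV; [exact/lt0r_neq0/nd0|exact: cont_nrm].
  - move=> x t Nx t01; apply: isconf_norms => [j|i j ij].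
      by apply: scalec_neq0; [rewrite divr_gt0 ?mulr_gt0 ?nd0|exact: d0].
    have sqE l : sq (scalec (lam l * nrm (coordX x ord0) * (nrm (d x t l))^-1) (d x t l))
        = (lam l * nrm (coordX x ord0)) ^+ 2.
      by rewrite dot_scalec dot_nrm -exprMn divfK // lt0r_neq0 // nd0.
    rewrite !sqE => /eqP; rewrite eqrXn2 // ?mulr_ge0 ?ltW //.
    rewrite (inj_eq (mulIf (lt0r_neq0 (nX0 x ord0)))) => /eqP.
    exact: rank_neq.
  - by move=> x j _; rewrite /d segment0 ndir invr1 mulr1.
  - move=> x j _; rewrite /d segment1.
    have -> : nrm (scalec (side x0 j) (dir x ord0)) = 1.
      by rewrite /nrm dot_scalec side2 mul1r -/(nrm _) ndir.
    rewrite invr1 mulr1 /dir !scalecA; congr scalec.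
    by field; rewrite lt0r_neq0.
(* All points now lie on the real line through [x_0]; rotations by fixed angles take the arguments 0
   and [pi] to those of [spread], while the moduli stay distinct. *)
have stage3 : htp r (nbh x0)
    (fun x j => scalec (lam j * side x0 j) (coordX x ord0))
    (fun x j => cmul (coordX x ord0) (scalec (lam j) (spread j))).
  pose be j : R := if `[< onray x0 0 ord0 j >] then 0 else pi.
  pose al (j : 'I_n) : R := 2 * pi * j%:R / (r * n)%N%:R.
  exists (fun x t j => cmul (coordX x ord0)
    (scalec (lam j) (cis (be j + t * (al j - be j))))); split.
  - move=> x t j _ _; apply: cont_cmul.
      by apply: (@cont_comp _ _ _ fst (fun y => coordX y ord0)); [exact: cvg_fst|exact: cX].
    apply: cont_scalec; first exact: cont_cst.
    have c : {for (x, t), continuous (fun y : X * R => be j + y.2 * (al j - be j))}.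
      apply: contD; first exact: cont_cst.
      by apply: contM; [exact: cvg_snd|exact: cont_cst].
    by apply: cont_pair; [exact: cont_cos|exact: cont_sin].
  - move=> x t _ _; apply: isconf_cmul => //; apply: isconf_norms => [j|i j ij].
      apply: scalec_neq0 => // E.
      have := dot_cis_self (be j + t * (al j - be j)).
      by rewrite E /dot /= mul0r addr0 => /esym/eqP; rewrite oner_eq0.
    rewrite !dot_scalec !dot_cis_self !mulr1 => /eqP.
    by rewrite eqrXn2 ?ltW // => /eqP; exact: rank_neq.
  - move=> x j _; rewrite mul0r addr0 cmul_scalec cmulC -scalecA; congr scalec.
    rewrite /be /side /cis; case: asboolP => _.
      by rewrite cos0 sin0 cmul1 scale1c.
    rewrite cospi sinpi; case: (coordX x ord0) => a b.
    by rewrite /cmul /scalec /=; congr (_, _); ring.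
  - by move=> x j _; rewrite mul1r addrC subrK.
(* Now the directions alone keep the orbits apart, so the moduli can be made equal. *)
have stage4 : htp r (nbh x0)
    (fun x j => cmul (coordX x ord0) (scalec (lam j) (spread j)))
    (fun x j => cmul (coordX x ord0) (spread j)).
  apply: htp_segment => [x j _|x j _|x t Nx t01].
  - by apply: cont_cmul; [exact: cX|exact: cont_cst].
  - by apply: cont_cmul; [exact: cX|exact: cont_cst].
  - case/andP: t01 => t0 t1.
    rewrite (_ : (fun j => _) = (fun j => cmul (coordX x ord0)
      (scalec ((1 - t) * lam j + t) (spread j)))); last first.
      by apply/funext => j; rewrite /segment /cmul /scalec; congr (_, _) => /=; ring.
    apply: isconf_cmul => //; apply: isconf_spread => j.
    have [->|tn0] := eqVneq t 0; first by rewrite subr0 mul1r addr0.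
    apply: ltr_wpDl; first by rewrite mulr_ge0 ?subr_ge0 // ltW.
    by rewrite lt_neqAle eq_sym tn0.
exact: htp_trans stage1 (htp_trans stage2 (htp_trans stage3 stage4)).
Qed.

End Moves.

(** * The upper bound *)

Section UpperBound.
Variables (R : realType) (r N : nat).
Hypothesis r0 : (0 < r)%N.
Local Notation n := N.+1.
Local Notation C := (R * R)%type.
Local Notation X := (orbit_conf_space R r n).
Local Notation spread := (@spread R r N).
Implicit Types z : X * X.

Lemma isconf_spread1 : isconf r spread.
Proof.
have -> : spread = (fun j => scalec 1 (spread j)) by apply/funext => j; rewrite scale1c.
by apply: isconf_spread.
Qed.

Lemma htp_scalar (T : topologicalType) (U : set T) (a b : T -> C) :
  (forall z : T, U z -> {for z, continuous a}) -> (forall z : T, U z -> {for z, continuous b}) ->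
  (forall z : T, U z -> a z <> (0, 0)) -> (forall z : T, U z -> b z <> (0, 0)) ->
  (forall z : T, U z -> ~ sameray (a z) (- b z)) ->
  htp r U (fun (z : T) j => cmul (a z) (spread j)) (fun (z : T) j => cmul (b z) (spread j)).
Proof.
move=> ca cb a0 b0 ab; apply: htp_segment => [z j Uz|z j Uz|z t Uz t01].
- by apply: cont_cmul; [exact: ca|exact: cont_cst].
- by apply: cont_cmul; [exact: cb|exact: cont_cst].
- rewrite (_ : (fun j => _) = (fun j => cmul (segment (a z) (b z) t) (spread j))).
    apply: isconf_cmul; last exact: isconf_spread1.
    by apply: segment_neq0 => //; [exact: a0|exact: b0|exact: ab].
  by apply/funext => j; rewrite /segment /cmul /scalec; congr (_, _) => /=; ring.
Qed.

Definition opposite z := sameray (coordX z.1 ord0) (- coordX z.2 ord0).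

Definition imul (a : C) : C := cmul (0, 1) a.

(** For opposite first points the route from [x_0] to [y_0] passes through [i * y_0]. This is
    orthogonal to [y_0], so only the first of the two segments imposes a condition. *)
Definition scalar_nbh z0 : set (X * X) :=
  if `[< opposite z0 >]
  then [set z | ~ sameray (coordX z.1 ord0) (- imul (coordX z.2 ord0))]
  else [set z | ~ opposite z].

Lemma imul_neq0 a : a <> (0, 0) -> imul a <> (0, 0).
Proof. by move=> a0; apply: cmul_neq0 => // -[/eqP]; rewrite oner_eq0. Qed.

Lemma cont_first z : {for z, continuous (fun y : X * X => coordX y.1 ord0)} /\
  {for z, continuous (fun y : X * X => coordX y.2 ord0)}.
Proof. by split; apply: cont_coordX; [exact: cvg_fst|exact: cvg_snd]. Qed.

Lemma cont_imul (T : topologicalType) (f : T -> C) x : {for x, continuous f} ->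
  {for x, continuous (fun y => imul (f y))}.
Proof. by move=> cf; apply: cont_cmul => //; exact: cont_cst. Qed.

Lemma near_opposite z0 : ~ opposite z0 -> \forall z \near z0, ~ opposite z.
Proof.
move=> off; have [c1 c2] := cont_first z0.
apply: near_notsameray.
- exact: c1.
- exact: cont_oppc.
- exact: coordX_neq0.
- by apply: oppc_neq0; exact: coordX_neq0.
- exact: off.
Qed.

Lemma scalar_nbh_open z0 : open (scalar_nbh z0).
Proof.
rewrite /scalar_nbh; case: asboolP => _; rewrite openE => z; last exact: near_opposite.
move=> /= off; have [c1 c2] := cont_first z.
suff : \forall y \near z, ~ sameray (coordX y.1 ord0) (- imul (coordX y.2 ord0)) by [].
apply: near_notsameray.
- exact: c1.
- by apply: cont_oppc; exact: cont_imul.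
- exact: coordX_neq0.
- by apply/oppc_neq0/imul_neq0; exact: coordX_neq0.
- exact: off.
Qed.

Lemma htp_scalar_nbh z0 : htp r (scalar_nbh z0)
  (fun z j => cmul (coordX z.1 ord0) (spread j))
  (fun z j => cmul (coordX z.2 ord0) (spread j)).
Proof.
have c1 z : {for z, continuous (fun y : X * X => coordX y.1 ord0)} by case: (cont_first z).
have c2 z : {for z, continuous (fun y : X * X => coordX y.2 ord0)} by case: (cont_first z).
rewrite /scalar_nbh; case: asboolP => _; last first.
  apply: htp_scalar => z; [move=> _|move=> _|move=> _|move=> _|].
  - exact: c1.
  - exact: c2.
  - exact: coordX_neq0.
  - exact: coordX_neq0.
  - exact.
apply: (@htp_trans _ _ _ _ _ _ (fun z j => cmul (imul (coordX z.2 ord0)) (spread j))).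
  apply: htp_scalar => z; [move=> _|move=> _|move=> _|move=> _|].
  - exact: c1.
  - by apply: cont_imul; exact: c2.
  - exact: coordX_neq0.
  - by apply: imul_neq0; exact: coordX_neq0.
  - exact.
apply: htp_scalar => z _.
- by apply: cont_imul; exact: c2.
- exact: c2.
- by apply: imul_neq0; exact: coordX_neq0.
- exact: coordX_neq0.
- have := @coordX_neq0 R r N z.2 ord0; case: (coordX _ _) => a b ab0 [_].
  have -> : dot (imul (a, b)) (- (a, b)) = 0 by rewrite /dot /imul /cmul /=; ring.
  by rewrite ltxx.
Qed.

Definition pair_nbh z0 : set (X * X) :=
  [set z | [/\ nbh z0.1 z.1, nbh z0.2 z.2 & scalar_nbh z0 z]].

Lemma pair_nbh_open z0 : open (pair_nbh z0).
Proof.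
have -> : pair_nbh z0 = fst @^-1` nbh z0.1 `&` snd @^-1` nbh z0.2 `&` scalar_nbh z0.
  by apply/seteqP; split=> z; [case|case=> -[]].
apply: openI; last exact: scalar_nbh_open.
apply: openI; apply: open_comp; try exact: nbh_open.
  by move=> z _; exact: cvg_fst.
by move=> z _; exact: cvg_snd.
Qed.

Lemma pair_nbh_planner z0 : motion_planner R (pair_nbh z0).
Proof.
apply: planner_of_htp; first exact: pair_nbh_open.
have cf : continuous (@fst X X) by move=> z; exact: cvg_fst.
have cs : continuous (@snd X X) by move=> z; exact: cvg_snd.
have h1 := htp_comp cf (htp_to_spread r0 z0.1).
have h2 := htp_comp cs (htp_to_spread r0 z0.2).
have s1 : pair_nbh z0 `<=` fst @^-1` nbh z0.1 by move=> z [].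
have s2 : pair_nbh z0 `<=` snd @^-1` nbh z0.2 by move=> z [].
have s3 : pair_nbh z0 `<=` scalar_nbh z0 by move=> z [].
apply: (@htp_trans _ _ _ _ _ _ (fun z j => cmul (coordX z.1 ord0) (spread j))).
  exact: (htp_sub s1 h1).
apply: (@htp_trans _ _ _ _ _ _ (fun z j => cmul (coordX z.2 ord0) (spread j))).
  exact: (htp_sub s3 (htp_scalar_nbh z0)).
by apply: htp_sym; exact: (htp_sub s2 h2).
Qed.

Definition pair_type z := (cell_type z.1, cell_type z.2, opposite z).

Definition pair_codim z := (codim z.1 + codim z.2 + `[< opposite z >])%N.

Lemma pair_codim_lt z : (pair_codim z < 2 * n)%N.
Proof.
have := codim_le z.1; have := codim_le z.2; rewrite /pair_codim mul2n -addnn addnS addSn ltnS.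
move=> c2 c1; apply: leq_trans (leq_add (leq_add c1 c2) (leq_b1 _)) _.
by rewrite addn1.
Qed.

(** None of the three summands can increase near [z0], so equality of the sums forces equality of
    each. *)
Lemma near_pair_type z0 : \forall z \near z0,
  pair_codim z = pair_codim z0 -> pair_type z = pair_type z0.
Proof.
have H1 : \forall z \near z0, (codim z.1 <= codim z0.1)%N /\
    (codim z.1 = codim z0.1 -> cell_type z.1 = cell_type z0.1).
  exact: (cvg_fst (near_cell_type r0 z0.1)).
have H2 : \forall z \near z0, (codim z.2 <= codim z0.2)%N /\
    (codim z.2 = codim z0.2 -> cell_type z.2 = cell_type z0.2).
  exact: (cvg_snd (near_cell_type r0 z0.2)).
have H3 : \forall z \near z0, opposite z -> opposite z0.
  have [on|/near_opposite off] := pselect (opposite z0).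
    by apply: filterS (@filterT _ (nbhs z0) _).
  by apply: filterS off => z off /off.
apply: filterS2 (filterI H1 H2) H3 => z [[le1 eq1] [le2 eq2]] op.
have le3 : (`[< opposite z >] <= `[< opposite z0 >])%N.
  by case: (asboolP (opposite z)) => // /op o0; rewrite asboolT.
rewrite /pair_codim => E.
have [e1 e2 e3] : [/\ codim z.1 = codim z0.1, codim z.2 = codim z0.2
    & nat_of_bool `[< opposite z >] = nat_of_bool `[< opposite z0 >]].
  move: (nat_of_bool `[< opposite z >]) (nat_of_bool `[< opposite z0 >]) le3 E => p q le3.
  by move: (codim z.1) (codim z0.1) (codim z.2) (codim z0.2) le1 le2 => *; split; lia.
rewrite /pair_type (eq1 e1) (eq2 e2); congr (_, _); apply/propext; split => // o0.
by move: e3; rewrite (asboolT o0); case: asboolP.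
Qed.

Theorem upper_bound : TC_le R X (2 * n).
Proof.
apply: (@TC_le_strata R (X : pseudoMetricType R) X _ _ pair_type pair_codim) => [||| z0].
- by [].
- exact: pair_codim_lt.
- exact: near_pair_type.
exists (pair_nbh z0); split.
- exact: pair_nbh_open.
- exact: pair_nbh_planner.
move=> z E; split.
- exact: cell_nbh (congr1 (fun p => p.1.1) E).
- exact: cell_nbh (congr1 (fun p => p.1.2) E).
have E3 : opposite z = opposite z0 := congr1 snd E.
rewrite /scalar_nbh -E3; case: asboolP => // on /= on'.
(* On this cell [x_0] has the direction of [- y_0], which is orthogonal to [- i * y_0]. *)
have [_] := sameray_trans (sameray_sym on) on'; case: (coordX z.2 ord0) => a b.
have -> : dot (- (a, b)) (- imul (a, b)) = 0 by rewrite /dot /imul /cmul /=; ring.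
by rewrite ltxx.
Qed.

End UpperBound.

(** * The value of the topological complexity *)

Theorem theorem5p3 (R : realType) (r n : nat) (hr : (1 <= r)%N) (hn : (1 <= n)%N) :
  is_TC R (orbit_conf_space R r n) (2 * n).
Proof.
case: n hn => // N _; split; first exact: upper_bound.
move=> k TCk; rewrite leqNgt; apply/negP => kn; apply: (@lower_bound R r N hr).
by apply: TC_le_mono TCk; rewrite mul2n -addnn addnS ltnS in kn.
Qed.
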